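(* For every function $f\in F^2$ and all real numbers $a$ and $b$, $$\|f'+zf-af\|\,\|f'-zf-ibf\|\ge\|f\|^2 .$$ As a consequence, if $f$ is a unit vector in $F^2$, then also: (a) $\operatorname{dist}(f'+zf,[f])\,\operatorname{dist}(f'-zf,[f])\ge 1$; (b) $\|f'+zf\|\,\|f'-zf\|\,|\sin(\theta_+)\sin(\theta_-)|\ge 1$; (c) $(\|f'\|^2+\|zf\|^2)\,|\sin(\theta_+)\sin(\theta_-)|\ge 1$. Here $[f]=\mathbb{C}f$ is the one-dimensional subspace of $F^2$ spanned by $f$, and $\theta_{\pm}$ are the angles between $f$ and $f'\pm zf$. Equality holds exactly in the following cases. For given real $a,b$, equality holds in the first inequality if and only if there exist a positive constant $c$ and a complex constant $C$ such that $$f(z)=C\exp\left(\frac{c-1}{2(c+1)}z^2+\frac{a+ibc}{c+1}z\right).$$ For a unit vector $f$, equality holds in (a), and likewise in (b), if and only if $f$ has the form $$f(z)=C\exp\left(\frac{c-1}{2(c+1)}z^2+\frac{a+ibc}{c+1}z\right)$$ for some positive $c$, some real $a$ and $b$, and some nonzero complex $C$ (these constants being such that $\|f\|=1$). For a unit vector $f$, equality holds in (c) if and only if $\|f'+zf\|=\|f'-zf\|$ and, for some positive constant $c$, $$f'+zf-\langle f'+zf,f\rangle f=-c\left[f'-zf-\langle f'-zf,f\rangle f\right].$$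
   Context: The Fock space is $F^2=L^2(\mathbb{C},d\lambda)\cap H(\mathbb{C})$, where $H(\mathbb{C})$ is the space of entire functions and $d\lambda(z)=\frac1\pi e^{-|z|^2}dA(z)$ with $dA$ ordinary area measure. It is a Hilbert space with $\langle f,g\rangle=\int_{\mathbb{C}} f\overline{g}\,d\lambda$ and $\|f\|^2=\int_{\mathbb{C}}|f|^2\,d\lambda$. Here $f'$ is the complex derivative and $zf$ denotes the function $z\mapsto zf(z)$. For an entire function $g$ not in $F^2$ we set $\|g\|=+\infty$. The distance is $\operatorname{dist}(g,[f])=\inf_{w\in\mathbb{C}}\|g-wf\|$. The angle $\theta$ between nonzero $f,g\in F^2$ is $\theta\in[0,\pi/2]$ with $\cos\theta=\frac{|\langle g,f\rangle|}{\|g\|\,\|f\|}$. When $f'\notin F^2$ (equivalently $zf\notin F^2$), the left-hand side of each inequality is regarded as $+\infty$, so the inequality is trivially true. *)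

(* Defs.v *)
From HB Require Import structures.
From mathcomp Require Import all_boot all_order all_algebra.
From mathcomp Require Import complex.
From mathcomp Require Import all_classical all_reals all_analysis.

Set Implicit Arguments.
Unset Strict Implicit.
Unset Printing Implicit Defensive.

Import Order.TTheory GRing.Theory Num.Theory numFieldNormedType.Exports.
Local Open Scope classical_set_scope.
Local Open Scope ring_scope.
Local Open Scope complex_scope.

Section Fock.
Variable R : realType.
Implicit Types f g : R[i] -> R[i].

(* [R[i]^o] carries the topology of the complex modulus and is a normed module
   over the field R[i] itself, so that [derivable] and [^`()] below are complex
   differentiability and the complex derivative. *)
Definition entire f : Prop :=
  forall z : R[i], derivable (f : R[i]^o -> R[i]^o) z 1.

Definition cderiv f : R[i] -> R[i] := (f : R[i]^o -> R[i]^o)^`()%classic.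

Definition mulz f : R[i] -> R[i] := fun z => z * f z.

(* The plane is parametrized by (x, y) |-> x + iy on R * R. *)
Definition area :
    {measure set (measurableTypeR R * measurableTypeR R) -> \bar R} :=
  (lebesgue_measure \x lebesgue_measure)%E.

(* the density of the Gaussian measure with respect to area *)
Definition gauss_weight (p : R * R) : R :=
  pi^-1 * expR (- (p.1 ^+ 2 + p.2 ^+ 2)).

Definition at_point f (p : R * R) : R[i] := f (p.1 +i* p.2).

(* The L^2 norm, with values in [0, +oo]: for an entire function it is +oo
   exactly when the function does not belong to the Fock space. *)
Definition fnorm f : \bar R :=
  sqrte (\int[area]_p
    (ComplexField.Normc.normc (at_point f p) ^+ 2 * gauss_weight p)%:E)%E.

(* Entire functions are continuous, hence measurable. *)
Definition fock f : Prop := entire f /\ (fnorm f < +oo)%E.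

(* A complex integral is computed on real and imaginary parts. *)
Definition inner f g : R[i] :=
  (\int[area]_p (complex.Re (at_point f p * (at_point g p)^*%C) * gauss_weight p))%R
  +i*
  (\int[area]_p (complex.Im (at_point f p * (at_point g p)^*%C) * gauss_weight p))%R.

Definition subZ g (w : R[i]) f : R[i] -> R[i] := fun z => g z - w * f z.

(* distance from g to the line spanned by f *)
Definition dist_line g f : \bar R :=
  ereal_inf [set fnorm (subZ g w f) | w in [set: R[i]]].

(* Meaningful for nonzero f and g in the Fock space; the argument of [acos] is
   then in [0, 1], so that the angle is in [0, pi/2]. *)
Definition angle f g : R :=
  acos (ComplexField.Normc.normc (inner g f)
        / (fine (fnorm g) * fine (fnorm f))).

Definition cexp (z : R[i]) : R[i] :=
  (expR (complex.Re z))%:C * (cos (complex.Im z) +i* sin (complex.Im z)).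

Definition extremal (a b c : R) (C : R[i]) : R[i] -> R[i] := fun z =>
  C * cexp (((c - 1) / (2 * (c + 1)))%:C * z ^+ 2
            + (a +i* (b * c)) / (c + 1)%:C * z).

Definition fplus f : R[i] -> R[i] := fun z => cderiv f z + mulz f z.
Definition fminus f : R[i] -> R[i] := fun z => cderiv f z - mulz f z.

(* The convention for the left-hand sides: they are +oo when f' is not in the
   Fock space (in which case, e.g., the angles below are meaningless). *)
Definition lhs f (x : \bar R) : \bar R :=
  if `[< fock (cderiv f) >] then x else +oo%E.

Definition lhs_norms f (a b : R) : \bar R :=
  lhs f (fnorm (subZ (fplus f) a%:C f)
         * fnorm (subZ (fminus f) (0%R +i* b)%C f))%E.

Definition lhs_dist f : \bar R :=
  lhs f (dist_line (fplus f) f * dist_line (fminus f) f)%E.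

Definition sin_angles f : R :=
  `| sin (angle f (fplus f)) * sin (angle f (fminus f)) |.

Definition lhs_prod f : \bar R :=
  lhs f (fnorm (fplus f) * fnorm (fminus f) * (sin_angles f)%:E)%E.

Definition lhs_sum f : \bar R :=
  lhs f ((fnorm (cderiv f) ^+ 2 + fnorm (mulz f) ^+ 2) * (sin_angles f)%:E)%E.

End Fock.

(* Main.v *)
(** Put [A f = f' + z f] and [B f = f' - z f].  On the Fock space the adjoint of
    differentiation is multiplication by [z], so [A] is symmetric, [B] is
    antisymmetric and [[d/dz, z] = 1]; hence [Re <(A - a) f, (B - i b) f> =
    ||f'||^2 - ||z f||^2 = - ||f||^2], and Cauchy-Schwarz gives the inequality.
    Equality means [(A - a) f = - c (B - i b) f] with [c > 0], a first order
    linear equation whose entire solutions are the stated Gaussians.  The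
    distances are attained at [a = <A f, f>], which is real, and at
    [i b = <B f, f>], which is imaginary.

    The two identities [<f', f> = <f, z f>] and [||z f||^2 = ||f'||^2 + ||f||^2]
    (including [z f] being square integrable) are obtained by integrating by
    parts in the plane against a compactly supported cutoff of the Gaussian
    weight, in terms of [S = |f|^2]: the divergence of [S (x, y)] and the
    identity [Delta S = 4 |f'|^2] in weak form.  Only the continuity of [f'] is
    used, so no Cauchy theory is needed. *)

Require Import Defs.
From HB Require Import structures.
From mathcomp Require Import all_boot all_order all_algebra.
From mathcomp Require Import complex.
From mathcomp Require Import all_classical all_reals all_analysis.
From mathcomp Require Import measurable_realfun ring lra.
Import Order.TTheory GRing.Theory Num.Theory numFieldNormedType.Exports.
Local Open Scope classical_set_scope.
Local Open Scope ring_scope.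
Local Open Scope complex_scope.

Set Implicit Arguments.
Unset Strict Implicit.
Unset Printing Implicit Defensive.

(** * Integration by parts in the plane *)

(** The obstacle is that nothing is known beforehand about [z f]: its square integrability must come
    out of that of [f] and [f']. Each of the two integrations by parts leaves a term in
    [x Sx + y Sy], of the size of |z| |f| |f'|, which is not yet controlled; they are combined so
    that this term cancels. What the cutoff adds is bounded by |f|^2 + |f'|^2 uniformly, since a
    cutoff that is a function of |z|^2 / N has bounded gradient and bounded radial derivative.
    Fatou's lemma then yields [z f]. Continuity of [f'] comes from the convention on the left-hand
    sides: they are finite only if [f'] is in the Fock space, hence entire. The Hilbert space
    arguments use only the real inner product Re <f, g>; the imaginary part is reached by testing
    against [i g]. Equality in the real Cauchy-Schwarz inequality at a negative value of the product
    is what produces a negative real factor -c. For every c > 0 one has |(c - 1) / (2 (c + 1))| <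
    1/2, so the derivative of an extremal function is in the Fock space; this reconciles the
    equality cases with the value +oo. *)

Lemma open_measurable2 (R : realType) (U : set (R * R)) : open U ->
  measurable (U : set (measurableTypeR R * measurableTypeR R)).
Proof.
move=> oU.
(* An open set is the union of the squares with rational centre and rational half-side that it
   contains, hence a countable union of products of intervals. *)
pose B (q r e : rat) : set (R * R) :=
  [set p : R * R | ball (ratr q : R) (ratr e) p.1 /\ ball (ratr r : R) (ratr e) p.2].
have -> : U = \bigcup_q \bigcup_r \bigcup_e
    (if `[< B q r e `<=` U >] then B q r e else set0).
  apply/seteqP; split=> [[x y] Uxy|p [q _ [r _ [e _]]]]; last first.
    by case: asboolP => // BU /BU.
  have [e /= e0 eU] : exists2 e : R, 0 < e & ball ((x, y) : R * R) e `<=` U.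
    by move: oU; rewrite openE => /(_ _ Uxy)/nbhs_ballP[e /= e0 eU]; exists e.
  have [d] : exists d : rat, ratr d \in `]0, (e / 2)[%R.
    by apply: rat_in_itvoo; rewrite divr_gt0.
  rewrite in_itv/= => /andP[d0 de].
  have xd : x < x + ratr d by rewrite ltrDl.
  have yd : y < y + ratr d by rewrite ltrDl.
  have [q] := rat_in_itvoo xd; have [r] := rat_in_itvoo yd.
  rewrite !in_itv/= => /andP[yr ry] /andP[xq qx].
  have Bd : B q r d `<=` U.
    move=> [s t] [/= s1 t1]; apply: eU; split => /=.
    - move: s1; rewrite /ball/= !ltr_distl => /andP[? ?]; apply/andP; split; lra.
    - move: t1; rewrite /ball/= !ltr_distl => /andP[? ?]; apply/andP; split; lra.
  exists q => //; exists r => //; exists d => //.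
  rewrite asboolT//; split => /=; rewrite /ball/= ltr_distl; apply/andP; split; lra.
apply: bigcupT_measurable_rat => q; apply: bigcupT_measurable_rat => r.
apply: bigcupT_measurable_rat => e; case: ifPn => _; last exact: measurable0.
apply: (@measurableX _ _ (measurableTypeR R) (measurableTypeR R)
  (ball (ratr q : R) (ratr e)) (ball (ratr r : R) (ratr e)));
  by rewrite ball_itv; exact: measurable_itv.
Qed.

Lemma continuous_measurable_fun2 (R : realType) (F : R * R -> R) :
  continuous F ->
  measurable_fun (setT : set (measurableTypeR R * measurableTypeR R)) F.
Proof.
move=> /continuousP cF; apply: (measurability _ (RGenOpens.measurableE R)).
move=> _ [_ [a [b ->] <-]]; rewrite setTI; apply: open_measurable2.
exact/cF/interval_open.
Qed.

Definition box (R : realType) (M : R) : set (R * R) :=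
  `[- M, M]%classic `*` `[- M, M]%classic.

Lemma box_measurable (R : realType) (M : R) :
  measurable (box M : set (measurableTypeR R * measurableTypeR R)).
Proof. by apply: measurableX; exact: measurable_itv. Qed.

Lemma continuous_bounded_box (R : realType) (F : R * R -> R) (M : R) :
  continuous F -> exists2 K : R, 0 <= K & forall p, box M p -> `|F p| <= K.
Proof.
move=> cF.
have cb : compact (box M) by apply: compact_setX; exact: segment_compact.
have : compact (F @` box M).
  by apply: continuous_compact => //; exact: continuous_subspaceT.
move=> /compact_bounded[K [_ HK]].
exists (Num.max 0 (K + 1)); first by rewrite le_max lexx.
move=> p bp; rewrite le_max; apply/orP; right.
apply: HK; first by rewrite ltrDl.
by exists p.
Qed.

Notation intg F := (Rintegral (area _) setT F).
Notation ible F := ((area _).-integrable setT (EFin \o F)).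

Lemma area_box_fin (R : realType) (M : R) : (area R (box M) < +oo)%E.
Proof.
have -> : area R (box M) = (@lebesgue_measure R `[(- M)%R, M]%classic
    * @lebesgue_measure R `[(- M)%R, M]%classic)%E.
  by apply: product_measure1E; exact: measurable_itv.
rewrite /= !lebesgue_measure_itv/=; case: ifP => _.
  by rewrite -EFinB -EFinM ltry.
by rewrite mule0 ltry.
Qed.

Lemma box_integrable (R : realType) (F : R * R -> R) (M : R) :
  continuous F -> (forall p, ~ box M p -> F p = 0) -> ible F.
Proof.
move=> cF F0.
have [K K0 FK] := continuous_bounded_box M cF.
have mF := continuous_measurable_fun2 cF.
have -> : EFin \o F = (EFin \o F) \_ (box M).
  apply/funext => p; rewrite patchE; case: ifPn => // /negP.
  by rewrite inE /= => /F0 ->.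
apply: (iffLR (integrable_mkcond _ (@box_measurable R M))).
apply: measurable_bounded_integrable.
- exact: box_measurable.
- exact: area_box_fin.
- exact: measurable_funTS.
- exists K; split; first exact: num_real.
  by move=> x Kx p bp; apply: le_trans (FK _ bp) (ltW Kx).
Qed.

Lemma integral_derive_compact (R : realType) (g g' : R -> R) (M : R) :
  continuous g' -> (forall x : R, is_derive x (1 : R) g (g' x)) ->
  (forall x, M < `|x| -> g x = 0 /\ g' x = 0) ->
  (\int[@lebesgue_measure R]_x (g' x)%:E = 0)%E.
Proof.
move=> cg' dg g0.
(* Whatever the sign of [M], the segment from [- a] to [a] is nondegenerate and its end points lie
   strictly outside the support. *)
pose a : R := `|M| + 1.
have a0 : 0 < a by rewrite ltr_wpDl.
have Ma : M < a by rewrite (le_lt_trans (ler_norm _))// ltrDl.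
have -> : (\int[@lebesgue_measure R]_x (g' x)%:E
          = \int[@lebesgue_measure R]_(x in `[(- a)%R, a]) (g' x)%:E)%E.
  rewrite [RHS]integral_mkcond; apply: eq_integral => x _.
  rewrite patchE; case: ifPn => // /negP; rewrite inE/= in_itv/= => nx.
  have /g0[_ ->//] : M < `|x|.
  rewrite (lt_le_trans Ma)// leNgt; apply/negP => xa; apply: nx.
  by rewrite -ler_norml ltW.
have dgx x : derivable g x 1 by have := dg x; case.
rewrite (@continuous_FTC2 _ g' g)//.
- have [-> _] := g0 a (lt_le_trans Ma (ler_norm _)).
  have [|-> _] := g0 (- a); last by rewrite subee.
  by rewrite normrN (lt_le_trans Ma (ler_norm _)).
- by rewrite (lt_trans _ a0)// oppr_lt0.
- exact: continuous_subspaceT.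
- have cg : continuous g by move=> x; apply/differentiable_continuous/derivable1_diffP.
  split => //.
  + by apply: cvg_at_right_filter; exact: cg.
  + by apply: cvg_at_left_filter; exact: cg.
- by move=> x _; rewrite derive1E; exact: (@derive_val _ _ _ _ _ _ _ (dg x)).
Qed.

Lemma continuous_slice1 (R : realType) (F : R * R -> R) y : continuous F ->
  continuous (fun x => F (x, y)).
Proof.
move=> cF x; apply: (continuous_comp (f := fun s : R => (s, y)) (g := F)).
  by apply: (@cvg_pair _ _ _ _ (nbhs (x : R)) (nbhs (y : R)));
    [exact: cvg_id|exact: cvg_cst].
exact: cF.
Qed.

Lemma continuous_slice2 (R : realType) (F : R * R -> R) x : continuous F ->
  continuous (fun y => F (x, y)).
Proof.
move=> cF y; apply: (continuous_comp (f := fun t : R => (x, t)) (g := F)).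
  by apply: (@cvg_pair _ _ _ _ (nbhs (x : R)) (nbhs (y : R)));
    [exact: cvg_cst|exact: cvg_id].
exact: cF.
Qed.

Lemma notin_box1 (R : realType) (M x y : R) : M < `|x| -> ~ box M (x, y).
Proof. by move=> + [/=]; rewrite in_itv/= -ler_norml ltNge => /negP h /h. Qed.

Lemma notin_box2 (R : realType) (M x y : R) : M < `|y| -> ~ box M (x, y).
Proof. by move=> + [/= _]; rewrite in_itv/= -ler_norml ltNge => /negP h /h. Qed.

(** By Fubini it suffices that the integral along every horizontal line vanishes, which is the
    one-dimensional statement. *)
Lemma intg_dx0 (R : realType) (F Fx : R * R -> R) (M : R) : continuous Fx ->
  (forall x y : R, is_derive x (1 : R) (fun s => F (s, y)) (Fx (x, y))) ->
  (forall p, ~ box M p -> F p = 0 /\ Fx p = 0) ->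
  intg Fx = 0.
Proof.
move=> cF dF F0.
have iF : ible Fx by apply: (@box_integrable _ _ M) => // p /F0[].
rewrite /Rintegral /area -integral21_prod_meas1//.
rewrite (eq_integral (cst 0%E)) => [|y _]; first by rewrite integral0.
apply: (@integral_derive_compact _ (fun s => F (s, y)) (fun s => Fx (s, y)) M).
- exact: continuous_slice1.
- by move=> x Mx; apply: F0; exact: notin_box1.
Qed.

Lemma intg_dy0 (R : realType) (F Fy : R * R -> R) (M : R) : continuous Fy ->
  (forall x y : R, is_derive y (1 : R) (fun t => F (x, t)) (Fy (x, y))) ->
  (forall p, ~ box M p -> F p = 0 /\ Fy p = 0) ->
  intg Fy = 0.
Proof.
move=> cF dF F0.
have iF : ible Fy by apply: (@box_integrable _ _ M) => // p /F0[].
rewrite /Rintegral /area -integral12_prod_meas1//.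
rewrite (eq_integral (cst 0%E)) => [|x _]; first by rewrite integral0.
apply: (@integral_derive_compact _ (fun t => F (x, t)) (fun t => Fy (x, t)) M).
- exact: continuous_slice2.
- by move=> y My; apply: F0; exact: notin_box2.
Qed.

Lemma intg_dominated (R : realType) (f_ : nat -> R * R -> R)
    (f g : R * R -> R) :
  (forall n, continuous (f_ n)) -> continuous f -> ible g ->
  (forall p, f_ n p @[n --> \oo] --> f p) ->
  (forall n p, `|f_ n p| <= g p) ->
  ible f /\ intg (f_ n) @[n --> \oo] --> intg f.
Proof.
move=> cf_ cf ig f_f f_g.
have [|||||If _ cI] := @dominated_convergence _ _ _ (area R) setT measurableT
    (fun n => EFin \o f_ n) (EFin \o f) (EFin \o g).
- by move=> n; apply/measurable_EFinP; exact: continuous_measurable_fun2 (cf_ n).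
- by apply/measurable_EFinP; exact: continuous_measurable_fun2 cf.
- by apply: aeW => p _; apply: cvg_comp (f_f p) _.
- exact: ig.
- by apply: aeW => p n _ /=; rewrite lee_fin.
split=> //; apply: fine_cvg.
rewrite fineK//.
by have := integrable_fin_num measurableT If.
Qed.

Lemma intgD (R : realType) (f g : R * R -> R) : ible f -> ible g ->
  intg (fun p => f p + g p) = intg f + intg g.
Proof. by move=> *; rewrite RintegralD. Qed.

Lemma intgB (R : realType) (f g : R * R -> R) : ible f -> ible g ->
  intg (fun p => f p - g p) = intg f - intg g.
Proof. by move=> *; rewrite RintegralB. Qed.

Lemma intgZ (R : realType) (k : R) (f : R * R -> R) : ible f ->
  intg (fun p => k * f p) = k * intg f.
Proof. by move=> *; rewrite RintegralZl. Qed.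

Lemma ibleD (R : realType) (f g : R * R -> R) : ible f -> ible g ->
  ible (fun p => f p + g p).
Proof. by move=> If Ig; exact: (integrableD measurableT If Ig). Qed.

Lemma ibleB (R : realType) (f g : R * R -> R) : ible f -> ible g ->
  ible (fun p => f p - g p).
Proof. by move=> If Ig; exact: (integrableB measurableT If Ig). Qed.

Lemma ibleZ (R : realType) (k : R) (f : R * R -> R) : ible f ->
  ible (fun p => k * f p).
Proof. by move=> If; exact: (integrableZl measurableT k If). Qed.

Lemma ible_le (R : realType) (f g : R * R -> R) : continuous f -> ible g ->
  (forall p, `|f p| <= g p) -> ible f.
Proof.
move=> cf Ig fg; apply: (le_integrable _ _ _ Ig) => //.
  by apply/measurable_EFinP; exact: continuous_measurable_fun2.
by move=> p _ /=; rewrite lee_fin (le_trans (fg p))// ler_norm.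
Qed.

(** The partial derivatives are carried as data and are jointly continuous, so that the closure
    lemmas below compute the derivatives of products and compositions together with their
    regularity. *)
Definition C1 (R : realType) (F Fx Fy : R * R -> R) :=
  [/\ continuous F, continuous Fx, continuous Fy,
   (forall x y : R, is_derive x (1 : R) (fun s => F (s, y)) (Fx (x, y))) &
   (forall x y : R, is_derive y (1 : R) (fun t => F (x, t)) (Fy (x, y)))].

Lemma C1_continuous (R : realType) (F Fx Fy : R * R -> R) :
  C1 F Fx Fy -> continuous F.
Proof. by case. Qed.

Section C1_closure.
Variable R : realType.
Implicit Types F G : R * R -> R.

Lemma C1D F Fx Fy G Gx Gy : C1 F Fx Fy -> C1 G Gx Gy ->
  C1 (fun p => F p + G p) (fun p => Fx p + Gx p) (fun p => Fy p + Gy p).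
Proof.
move=> [cF cFx cFy dFx dFy] [cG cGx cGy dGx dGy]; split.
- by move=> p; apply: cvgD; [exact: cF|exact: cG].
- by move=> p; apply: cvgD; [exact: cFx|exact: cGx].
- by move=> p; apply: cvgD; [exact: cFy|exact: cGy].
- by move=> x y; exact: is_deriveD.
- by move=> x y; exact: is_deriveD.
Qed.

Lemma C1N F Fx Fy : C1 F Fx Fy ->
  C1 (fun p => - F p) (fun p => - Fx p) (fun p => - Fy p).
Proof.
move=> [cF cFx cFy dFx dFy]; split.
- by move=> p; apply: cvgN; exact: cF.
- by move=> p; apply: cvgN; exact: cFx.
- by move=> p; apply: cvgN; exact: cFy.
- by move=> x y; exact: is_deriveN.
- by move=> x y; exact: is_deriveN.
Qed.

Lemma C1M F Fx Fy G Gx Gy : C1 F Fx Fy -> C1 G Gx Gy ->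
  C1 (fun p => F p * G p) (fun p => F p * Gx p + Fx p * G p)
     (fun p => F p * Gy p + Fy p * G p).
Proof.
move=> [cF cFx cFy dFx dFy] [cG cGx cGy dGx dGy]; split.
- by move=> p; apply: cvgM; [exact: cF|exact: cG].
- by move=> p; apply: cvgD; apply: cvgM; [exact: cF|exact: cGx|exact: cFx|exact: cG].
- by move=> p; apply: cvgD; apply: cvgM; [exact: cF|exact: cGy|exact: cFy|exact: cG].
- by move=> x y; apply: is_derive_eq; rewrite /GRing.scale/= [in X in _ + X]mulrC.
- by move=> x y; apply: is_derive_eq; rewrite /GRing.scale/= [in X in _ + X]mulrC.
Qed.

Lemma C1_eq F Fx Fy G Gx Gy : C1 F Fx Fy -> F =1 G -> Fx =1 Gx -> Fy =1 Gy ->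
  C1 G Gx Gy.
Proof. by move=> + /funext <- /funext <- /funext <-. Qed.

Lemma C1_cst (c : R) : @C1 R (fun=> c) (fun=> 0) (fun=> 0).
Proof.
by split; try (move=> p; exact: cvg_cst); move=> x y; exact: is_derive_cst.
Qed.

Lemma C1_fst : @C1 R (fun p => p.1) (fun=> 1) (fun=> 0).
Proof.
split; try (move=> p; exact: cvg_cst).
- by move=> p; exact: cvg_fst.
- by move=> x y; exact: is_derive_id.
- by move=> x y; exact: is_derive_cst.
Qed.

Lemma C1_snd : @C1 R (fun p => p.2) (fun=> 0) (fun=> 1).
Proof.
split; try (move=> p; exact: cvg_cst).
- by move=> p; exact: cvg_snd.
- by move=> x y; exact: is_derive_cst.
- by move=> x y; exact: is_derive_id.
Qed.

Lemma C1_comp F Fx Fy (g g' : R -> R) : C1 F Fx Fy -> continuous g' ->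
  (forall t : R, is_derive t (1 : R) g (g' t)) ->
  C1 (fun p => g (F p)) (fun p => g' (F p) * Fx p) (fun p => g' (F p) * Fy p).
Proof.
move=> [cF cFx cFy dFx dFy] cg' dg.
have cg : continuous g.
  move=> t; apply/differentiable_continuous/derivable1_diffP.
  by have := dg t; case.
split.
- by move=> p; apply: continuous_comp; [exact: cF|exact: cg].
- move=> p; apply: cvgM; last exact: cFx.
  by apply: continuous_comp; [exact: cF|exact: cg'].
- move=> p; apply: cvgM; last exact: cFy.
  by apply: continuous_comp; [exact: cF|exact: cg'].
- move=> x y.
  exact: (@is_derive1_comp _ g (fun s => F (s, y)) _ _ _ (dg _) (dFx x y)).
- move=> x y.
  exact: (@is_derive1_comp _ g (fun t => F (x, t)) _ _ _ (dg _) (dFy x y)).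
Qed.

Lemma C1_shift F Fx Fy (h : R) : C1 F Fx Fy ->
  C1 (fun p => F (p.1 + h, p.2)) (fun p => Fx (p.1 + h, p.2))
     (fun p => Fy (p.1 + h, p.2)).
Proof.
move=> [cF cFx cFy dFx dFy].
have cs : continuous (fun p : R * R => (p.1 + h, p.2)).
  move=> p; apply: (@cvg_pair _ _ _ _ (nbhs (p.1 + h : R)) (nbhs (p.2 : R))).
    by apply: cvgD; [exact: cvg_fst|exact: cvg_cst].
  exact: cvg_snd.
split.
- by move=> p; apply: continuous_comp; [exact: cs|exact: cF].
- by move=> p; apply: continuous_comp; [exact: cs|exact: cFx].
- by move=> p; apply: continuous_comp; [exact: cs|exact: cFy].
- move=> x y /=; rewrite -[Fx _]mulr1.
  apply: (@is_derive1_comp _ (fun s => F (s, y)) (fun s => s + h)).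
  by apply: is_derive_eq; rewrite addr0.
- by move=> x y; exact: (dFy (x + h) y).
Qed.

Lemma C1_intg0 F Fx Fy M : C1 F Fx Fy ->
  (forall p, ~ box M p -> [/\ F p = 0, Fx p = 0 & Fy p = 0]) ->
  [/\ ible Fx, ible Fy, intg Fx = 0 & intg Fy = 0].
Proof.
move=> [cF cFx cFy dFx dFy] F0; split.
- by apply: (box_integrable (M := M)) => // p /F0[].
- by apply: (box_integrable (M := M)) => // p /F0[].
- by apply: (@intg_dx0 _ F _ M) => // p /F0[].
- by apply: (@intg_dy0 _ F _ M) => // p /F0[].
Qed.

End C1_closure.

(* The Cauchy-Riemann equation of the derivative [p + i q] of [u + i v], tested
   against [phi].  Continuity of the second derivatives is not available, so the
   equation is proved for horizontal difference quotients of [u + i v] and then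
   passed to the limit. *)
Section weak_Cauchy_Riemann.
Variables (R : realType) (u v p q phi phix phiy : R * R -> R) (M : R).
Hypotheses (Cu : C1 u p (fun z => - q z)) (Cv : C1 v q p).
Hypothesis Cphi : C1 phi phix phiy.
Hypothesis phi0 :
  forall z, ~ box M z -> [/\ phi z = 0, phix z = 0 & phiy z = 0].

Let continuous_u : continuous u. Proof. by case: Cu. Qed.
Let continuous_v : continuous v. Proof. by case: Cv. Qed.
Let continuous_p : continuous p. Proof. by case: Cv. Qed.
Let continuous_q : continuous q. Proof. by case: Cv. Qed.
Let continuous_phix : continuous phix. Proof. by case: Cphi. Qed.
Let continuous_phiy : continuous phiy. Proof. by case: Cphi. Qed.

Let shiftx (h : R) (z : R * R) : R * R := (z.1 + h, z.2).

Let continuous_shiftx h : continuous (shiftx h).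
Proof.
move=> z; apply: (@cvg_pair _ _ _ _ (nbhs (z.1 + h : R)) (nbhs (z.2 : R))).
  by apply: cvgD; [exact: cvg_fst|exact: cvg_cst].
exact: cvg_snd.
Qed.

Let cross_ible (a b : R * R -> R) : continuous a -> continuous b ->
  ible (fun z => phix z * a z - phiy z * b z).
Proof.
move=> ca cb; apply: (box_integrable (M := M)).
  by move=> z; apply: cvgB; apply: cvgM;
    [exact: continuous_phix|exact: ca|exact: continuous_phiy|exact: cb].
by move=> z /phi0[_ -> ->]; rewrite !mul0r subr0.
Qed.

(** The integrand is the divergence of [(phi u, - phi v)] with [u] and [v] translated: the
    undifferentiated [phi] is multiplied by u_x - v_y = p - p = 0. Translation preserves the
    Cauchy-Riemann equations, so this holds for each [h], and by linearity for difference
    quotients. *)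
Let cross_intg0 (h : R) :
  intg (fun z => phix z * u (shiftx h z) - phiy z * v (shiftx h z)) = 0.
Proof.
have Cuh := C1_shift h Cu; have Cvh := C1_shift h Cv.
have [|I1 _ E1 _] := C1_intg0 (M := M) (C1M Cphi Cuh).
  by move=> z /phi0[-> -> ->]; rewrite !mul0r addr0.
have [|_ I2 _ E2] := C1_intg0 (M := M) (C1M Cphi Cvh).
  by move=> z /phi0[-> -> ->]; rewrite !mul0r addr0.
have := intgB I1 I2; rewrite E1 E2 subr0 => <-.
by congr (intg _); apply/funext => z; rewrite /shiftx; ring.
Qed.

Let dq (h : R) (w : R * R -> R) (z : R * R) := h^-1 * (w (shiftx h z) - w z).

Let dq_intg0 (h : R) : intg (fun z => phix z * dq h u z - phiy z * dq h v z) = 0.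
Proof.
have I1 : ible (fun z => phix z * u (shiftx h z) - phiy z * v (shiftx h z)).
  by apply: cross_ible => z; apply: continuous_comp; (exact: continuous_shiftx ||
    exact: continuous_u || exact: continuous_v).
have I2 : ible (fun z => phix z * u z - phiy z * v z) by apply: cross_ible.
have := intgZ h^-1 (ibleB I1 I2); rewrite intgB// cross_intg0.
have -> : intg (fun z => phix z * u z - phiy z * v z) = 0.
  rewrite -(cross_intg0 0); congr (intg _); apply/funext => -[x y].
  by rewrite /shiftx/= addr0.
rewrite subr0 mulr0 => <-; congr (intg _); apply/funext => z.
by rewrite /dq; ring.
Qed.

Let continuous_dq h w : continuous w -> continuous (dq h w).
Proof.
move=> cw z; apply: cvgM; first exact: cvg_cst.
apply: cvgB; last exact: cw.
by apply: continuous_comp; [exact: continuous_shiftx|exact: cw].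
Qed.

(** The mean value theorem. The box is enlarged by 1 because the intermediate point may leave the
    original one by at most [h <= 1]; the bound is uniform in [h], as dominated convergence
    requires. *)
Let dq_bound (w wx : R * R -> R) (K h : R) z :
  (forall x y : R, is_derive x (1 : R) (fun s => w (s, y)) (wx (x, y))) ->
  (forall z, box (`|M| + 1) z -> `|wx z| <= K) ->
  0 < h -> h <= 1 -> box M z -> `|dq h w z| <= K.
Proof.
case: z => x y dw wK h0 h1 [/=]; rewrite !in_itv/= -!ler_norml => xM yM.
have [||c] := @MVT _ (fun s => w (s, y)) (fun s => wx (s, y)) x (x + h).
- by rewrite ltrDl.
- apply: derivable_within_continuous => s _.
  by have := dw s y; case.
rewrite in_itv/= => /andP[xc ch] E.
rewrite /dq /shiftx/= E [x + h]addrC addrK mulrC mulfK ?gt_eqF//.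
apply: wK; split; rewrite /= in_itv/= -ler_norml.
  have := ler_norm M; move: xM; rewrite !ler_norml => /andP[? ?] ?.
  by apply/andP; split; lra.
by have := ler_norm M; lra.
Qed.

Let dq_cvg (w wx : R * R -> R) z :
  (forall x y : R, is_derive x (1 : R) (fun s => w (s, y)) (wx (x, y))) ->
  dq n.+1%:R^-1 w z @[n --> \oo] --> wx z.
Proof.
case: z => x y dw.
have [dx ex] := dw x y.
have := dx; rewrite /derivable => /cvg_ex[/= l Hl].
have <- : l = wx (x, y).
  by rewrite -ex; apply/esym; apply: cvg_lim.
have H : harmonic n @[n --> \oo] --> (0 : R)^'.
  move=> A; rewrite /dnbhs /within => A0.
  change (\forall n \near \oo, A (harmonic n)); near=> n.
  have : harmonic n != 0 :> R by rewrite gt_eqF// harmonic_gt0.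
  by near: n; exact: (@cvg_harmonic R _ A0).
have := cvg_comp _ _ H Hl.
apply: cvg_trans; apply: near_eq_cvg; near=> n.
by rewrite /= /dq /shiftx/= /GRing.scale/= mulr1 [_ + x]addrC.
Unshelve. all: end_near. Qed.

Lemma weak_Cauchy_Riemann :
  intg (fun z => phix z * p z - phiy z * q z) = 0.
Proof.
have [Kp Kp0 HKp] := continuous_bounded_box (`|M| + 1) continuous_p.
have [Kq Kq0 HKq] := continuous_bounded_box (`|M| + 1) continuous_q.
pose F n z := phix z * dq n.+1%:R^-1 u z - phiy z * dq n.+1%:R^-1 v z.
have dux : forall x y : R, is_derive x (1 : R) (fun s => u (s, y)) (p (x, y)).
  by case: Cu.
have dvx : forall x y : R, is_derive x (1 : R) (fun s => v (s, y)) (q (x, y)).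
  by case: Cv.
have [|||||_ cF] := @intg_dominated _ F (fun z => phix z * p z - phiy z * q z)
    (fun z => `|phix z| * Kp + `|phiy z| * Kq).
- move=> n z; apply: cvgB; apply: cvgM;
    [exact: continuous_phix| |exact: continuous_phiy|];
    exact: continuous_dq.
- by move=> z; apply: cvgB; apply: cvgM;
    [exact: continuous_phix|exact: continuous_p|exact: continuous_phiy|
     exact: continuous_q].
- apply: (box_integrable (M := M)).
    by move=> z; apply: cvgD; apply: cvgM; (exact: cvg_cst ||
      (apply: cvg_norm; (exact: continuous_phix || exact: continuous_phiy))).
  by move=> z /phi0[_ -> ->]; rewrite normr0 !mul0r addr0.
- by move=> z; apply: cvgB; apply: cvgM; (exact: cvg_cst || exact: dq_cvg).
- move=> n z; have [bz|/phi0[_ phix0 phiy0]] := pselect (box M z); last first.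
    by rewrite /F phix0 phiy0 !mul0r subr0 normr0 !mul0r addr0.
  have n0 : (0 : R) < n.+1%:R^-1 by [].
  have n1 : n.+1%:R^-1 <= (1 : R) by rewrite invf_le1// ler1n.
  rewrite (le_trans (ler_normB _ _))// (normrM (phix z)) (normrM (phiy z)) lerD// ler_wpM2l//.
    exact: (dq_bound dux HKp n0 n1 bz).
  exact: (dq_bound dvx HKq n0 n1 bz).
apply/esym/(cvg_unique _ _ cF); first exact: Rhausdorff.
have -> : (fun n => intg (F n)) = cst 0 by apply/funext => n; exact: dq_intg0.
exact: cvg_cst.
Qed.

End weak_Cauchy_Riemann.

(** * Energy identities *)

Section cutoff.
Variable R : realType.

(** The square makes the truncation continuously differentiable at t = 1. For t negative the profile
    is unbounded, but it is only evaluated at t >= 0. *)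
Definition bump (t : R) : R := Num.max 0 (1 - t) ^+ 2.
Definition dbump (t : R) : R := - (2 * Num.max 0 (1 - t)).

Lemma continuous_dbump : continuous dbump.
Proof.
move=> t; apply: cvgN; apply: cvgM; first exact: cvg_cst.
apply: (@continuous_max _ _ (fun=> 0) (fun s : R => 1 - s)).
  exact: cvg_cst.
by apply: cvgB; [exact: cvg_cst|exact: cvg_id].
Qed.

(** [dbump] is Lipschitz with constant 2, which bounds the first order remainder by [h ^+ 2], across
    the junction at 1 as well. *)
Lemma bump_taylor (t h : R) : `|bump (t + h) - bump t - h * dbump t| <= h ^+ 2.
Proof.
rewrite /bump /dbump ler_norml !maxEle.
by case: ifPn => [|/negbTE]; case: ifPn => [|/negbTE];
  rewrite ?leNgt => ? ?; apply/andP; split; nra.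
Qed.

Lemma is_derive_bump (t : R) : is_derive t (1 : R) bump (dbump t).
Proof.
have H : h^-1 *: (bump (h *: 1 + t) - bump t) @[h --> (0 : R)^'] --> dbump t.
  apply/cvgrPdist_le => e e0; near=> h.
  have h0 : h != 0 by near: h; exact: nbhs_dnbhs_neq.
  have he : `|h| <= e.
    near: h; apply: cvg_within; apply/nbhs_ballP; exists e => //= h.
    by rewrite /ball/= sub0r normrN => /ltW.
  have -> : dbump t - h^-1 *: (bump (h *: 1 + t) - bump t) =
      - h^-1 * (bump (t + h) - bump t - h * dbump t).
    by rewrite /GRing.scale/= mulr1 [h + t]addrC; field.
  rewrite normrM normrN normrV ?unitfE// ler_pdivrMl ?normr_gt0//.
  apply: le_trans (bump_taylor t h) _.
  have -> : h ^+ 2 = `|h| * `|h| by rewrite -normrM -expr2 ger0_norm ?sqr_ge0.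
  by rewrite ler_pM2l ?normr_gt0.
split; last by apply: cvg_lim => //.
by apply/cvg_ex; eexists; exact: H.
Unshelve. all: end_near. Qed.

Definition nsq (z : R * R) : R := z.1 ^+ 2 + z.2 ^+ 2.

Lemma C1_nsq : C1 nsq (fun z => 2 * z.1) (fun z => 2 * z.2).
Proof.
apply: (C1_eq (C1D (C1M (C1_fst R) (C1_fst R)) (C1M (C1_snd R) (C1_snd R)))) => z /=;
  rewrite /nsq; ring.
Qed.

Lemma C1_gauss : C1 (@gauss_weight R)
  (fun z => - 2 * z.1 * gauss_weight z) (fun z => - 2 * z.2 * gauss_weight z).
Proof.
have H := C1_comp (C1N C1_nsq) (@continuous_expR R) (@is_derive_expR R).
apply: (C1_eq (C1M (C1_cst pi^-1) H)) => z /=; rewrite /gauss_weight /nsq; ring.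
Qed.

(** Supported in the disc of radius sqrt (n + 1). Scaling |z|^2 by n + 1 makes the gradient tend to
    0 pointwise while staying bounded. *)
Definition cutoff (n : nat) (z : R * R) : R := bump (n.+1%:R^-1 * nsq z).
Definition cutoffx (n : nat) (z : R * R) : R :=
  dbump (n.+1%:R^-1 * nsq z) * (n.+1%:R^-1 * (2 * z.1)).
Definition cutoffy (n : nat) (z : R * R) : R :=
  dbump (n.+1%:R^-1 * nsq z) * (n.+1%:R^-1 * (2 * z.2)).

Lemma C1_cutoff n : C1 (cutoff n) (cutoffx n) (cutoffy n).
Proof.
have H := C1_comp (C1M (C1_cst n.+1%:R^-1) C1_nsq) continuous_dbump is_derive_bump.
apply: (C1_eq H) => z //=; rewrite ?/cutoffx ?/cutoffy; ring.
Qed.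

Lemma cutoff_outside n z : ~ box n.+1%:R z ->
  [/\ cutoff n z = 0, cutoffx n z = 0 & cutoffy n z = 0].
Proof.
move=> nz.
have H : 1 - n.+1%:R^-1 * nsq z <= 0.
  rewrite subr_le0 ler_pdivlMl// mulr1 leNgt; apply/negP => zn; apply: nz.
  (* Since N = n + 1 is at least 1, c^2 <= N implies |c| <= N: the disc of radius sqrt N lies in the
     box of half-side N. *)
  have n1 : (1 : R) <= n.+1%:R by rewrite ler1n.
  move: z zn => [x y]; rewrite /nsq/= => zn.
  have cN (c : R) : c ^+ 2 <= n.+1%:R -> - n.+1%:R <= c <= n.+1%:R.
    move: (n.+1%:R : R) n1 => N N1 cN.
    rewrite -ler_norml -(@ler_pXn2r _ 2) ?nnegrE// ?(le_trans ler01)//.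
    by rewrite real_normK ?num_real// (le_trans cN)// expr2 ler_peMl// (le_trans ler01).
  have := sqr_ge0 x; have := sqr_ge0 y => y0 x0.
  by split; rewrite /= in_itv/=; apply: cN; lra.
rewrite /cutoff /cutoffx /cutoffy /bump /dbump (max_l H).
by rewrite expr0n mulr0 oppr0 !mul0r.
Qed.

Lemma nsq_ge0 z : 0 <= nsq z.
Proof. by rewrite addr_ge0 ?sqr_ge0. Qed.

Lemma cutoff_ge0 n z : 0 <= cutoff n z.
Proof. exact: sqr_ge0. Qed.

Lemma cutoff_le1 n z : cutoff n z <= 1.
Proof.
rewrite /cutoff /bump.
have : 0 <= n.+1%:R^-1 * nsq z by rewrite mulr_ge0 ?nsq_ge0.
move: (_ * nsq z) => t t0; case: (lerP 0 (1 - t)) => ?; first by nra.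
by rewrite expr0n.
Qed.

(** With t = |z|^2 / (n + 1) the radial derivative is 2 t [dbump] t, a bounded function of t >= 0
    that vanishes beyond 1. Thus the unbounded factor [z] costs nothing. *)
Lemma cutoff_radial_le n z : `|z.1 * cutoffx n z + z.2 * cutoffy n z| <= 2.
Proof.
have -> : z.1 * cutoffx n z + z.2 * cutoffy n z =
    2 * (n.+1%:R^-1 * nsq z) * dbump (n.+1%:R^-1 * nsq z).
  by rewrite /cutoffx /cutoffy /nsq; ring.
have : 0 <= n.+1%:R^-1 * nsq z by rewrite mulr_ge0 ?nsq_ge0.
move: (_ * nsq z) => t t0; rewrite /dbump ler_norml.
by case: (lerP 0 (1 - t)) => ?; apply/andP; split; nra.
Qed.

(** When |c| is at most n + 1, both factors are at most 2; when |z|^2 is at least n + 1, [dbump]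
    vanishes. *)
Lemma dbump_mul_le n z c : `|c| <= n.+1%:R \/ n.+1%:R <= nsq z ->
  `|dbump (n.+1%:R^-1 * nsq z) * (n.+1%:R^-1 * (2 * c))| <= 4.
Proof.
have t0 : 0 <= n.+1%:R^-1 * nsq z by rewrite mulr_ge0 ?nsq_ge0.
case=> [cn|zn]; last first.
  rewrite /dbump max_l ?mulr0 ?oppr0 ?mul0r ?normr0//.
  by rewrite subr_le0 ler_pdivlMl// mulr1.
have -> : 4 = 2 * 2 :> R by rewrite -natrM.
rewrite normrM ler_pM//.
  rewrite /dbump normrN ger0_norm ?mulr_ge0// ?le_max ?lexx//.
  by rewrite ler_piMr// ge_max ler01/= gerBl.
by rewrite !normrM normfV !normr_nat ler_pdivrMl// mulrC ler_pM2r.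
Qed.

Lemma sqr_le_norm_le (c N m : R) : 1 <= N -> c ^+ 2 <= m -> `|c| <= N \/ N <= m.
Proof.
move=> N1 cm; have [Nm|mN] := leP N m; [by right|left].
rewrite -(@ler_pXn2r _ 2) ?nnegrE// ?(le_trans ler01)//.
by rewrite real_normK ?num_real//; nra.
Qed.

Lemma cutoffx_le n z : `|cutoffx n z| <= 4.
Proof.
by apply: dbump_mul_le; apply: sqr_le_norm_le; rewrite ?ler1n// lerDl sqr_ge0.
Qed.

Lemma cutoffy_le n z : `|cutoffy n z| <= 4.
Proof.
by apply: dbump_mul_le; apply: sqr_le_norm_le; rewrite ?ler1n// lerDr sqr_ge0.
Qed.

Lemma cvg_invn_mul (c : R) : n.+1%:R^-1 * c @[n --> \oo] --> (0 : R).
Proof.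
rewrite -(mul0r c); apply: cvgM; last exact: cvg_cst.
exact: cvg_harmonic.
Qed.

Lemma cutoff_cvg z : cutoff n z @[n --> \oo] --> (1 : R).
Proof.
have -> : 1 = bump 0 by rewrite /bump subr0 max_r// expr1n.
apply: (@continuous_cvg _ _ _ _ _ (fun n : nat => n.+1%:R^-1 * nsq z) bump (0 : R));
  last exact: cvg_invn_mul.
by apply/differentiable_continuous/derivable1_diffP; have := is_derive_bump 0; case.
Qed.

Lemma cvg_dbump z c : dbump (n.+1%:R^-1 * nsq z) * (n.+1%:R^-1 * c) @[n --> \oo] --> (0 : R).
Proof.
rewrite -(mulr0 (dbump 0)); apply: cvgM; last exact: cvg_invn_mul.
apply: (@continuous_cvg _ _ _ _ _ (fun n : nat => n.+1%:R^-1 * nsq z) dbump (0 : R));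
  last exact: cvg_invn_mul.
exact: continuous_dbump.
Qed.

Lemma cutoffx_cvg z : cutoffx n z @[n --> \oo] --> (0 : R).
Proof. exact: cvg_dbump. Qed.

Lemma cutoffy_cvg z : cutoffy n z @[n --> \oo] --> (0 : R).
Proof. exact: cvg_dbump. Qed.

End cutoff.

Section continuity.
Variable R : realType.
Implicit Types f g : R * R -> R.

Lemma continuous_cst2 (c : R) : continuous (fun _ : R * R => c).
Proof. by move=> z; exact: cvg_cst. Qed.

Lemma continuous_fst2 : continuous (fun z : R * R => z.1).
Proof. by move=> z; exact: cvg_fst. Qed.

Lemma continuous_snd2 : continuous (fun z : R * R => z.2).
Proof. by move=> z; exact: cvg_snd. Qed.

Lemma continuousD2 f g : continuous f -> continuous g ->
  continuous (fun z => f z + g z).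
Proof. by move=> cf cg z; apply: cvgD; [exact: cf|exact: cg]. Qed.

Lemma continuousN2 f : continuous f -> continuous (fun z => - f z).
Proof. by move=> cf z; apply: cvgN; exact: cf. Qed.

Lemma continuousM2 f g : continuous f -> continuous g ->
  continuous (fun z => f z * g z).
Proof. by move=> cf cg z; apply: cvgM; [exact: cf|exact: cg]. Qed.

Lemma continuousX2 f n : continuous f -> continuous (fun z => f z ^+ n).
Proof.
move=> cf z.
exact: (continuous_comp (g := fun t : R => t ^+ n) (cf z) (@exprn_continuous _ n _)).
Qed.

Lemma continuous_norm2 f : continuous f -> continuous (fun z => `|f z|).
Proof. by move=> cf z; apply: cvg_norm; exact: cf. Qed.

End continuity.

(* Atoms are compared with [constr_eq]: unifying them up to conversion is
   prohibitively slow. *)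
Ltac cts := lazymatch goal with
  | |- continuous (fun z => _ + _) => apply: continuousD2; cts
  | |- continuous (fun z => _ * _) => apply: continuousM2; cts
  | |- continuous (fun z => - _) => apply: continuousN2; cts
  | |- continuous (fun z => _ ^+ _) => apply: continuousX2; cts
  | |- continuous (fun z => `| _ |) => apply: continuous_norm2; cts
  | |- continuous ?f =>
      match goal with
      | H : continuous ?g |- _ => constr_eq f g; exact H
      | |- _ => exact: continuous_fst2
      | |- _ => exact: continuous_snd2
      | |- _ => exact: continuous_cst2
      end
  end.

(** Fatou's lemma: the limit function is nonnegative and its integral is at most [l], so
    integrability is a conclusion, with no dominating function available. *)
Lemma ge0_cvg_ible (R : realType) (T_ : nat -> R * R -> R) (f : R * R -> R)
    (l : R) :
  (forall n, continuous (T_ n)) -> continuous f ->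
  (forall n p, 0 <= T_ n p) -> (forall n, ible (T_ n)) ->
  (forall p, T_ n p @[n --> \oo] --> f p) ->
  intg (T_ n) @[n --> \oo] --> l -> ible f.
Proof.
move=> cT cf T0 iT Tf Tl.
have f0 p : 0 <= f p.
  rewrite -(cvg_lim (@Rhausdorff R) (Tf p)); apply: limr_ge.
    by apply/cvg_ex; exists (f p); exact: Tf.
  by apply: nearW => n; exact: T0.
have [mf mT] : measurable_fun setT (EFin \o f : _ -> \bar R) /\
    forall n, measurable_fun setT (EFin \o T_ n : _ -> \bar R).
  split; first by apply/measurable_EFinP; exact: continuous_measurable_fun2.
  by move=> n; apply/measurable_EFinP; exact: continuous_measurable_fun2 (cT n).
apply/integrableP; split => //.
under eq_integral => p _ do rewrite /= ger0_norm//.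
have := @fatou _ _ _ (area R) setT measurableT (fun n => EFin \o T_ n) mT
  (fun n p _ => T0 n p).
rewrite (_ : (fun x => limn_einf _) = EFin \o f); last first.
  apply/funext => p; apply: (cvg_limn_einf_sup _).1.
  exact: cvg_comp (Tf p) _.
move=> /le_lt_trans; apply.
have -> : (fun n => \int[area R]_p (EFin \o T_ n) p)%E = (fun n => (intg (T_ n))%:E).
  apply/funext => n; rewrite /Rintegral fineK//.
  exact: (integrable_fin_num measurableT (iT n)).
rewrite (cvg_limn_einf_sup (l := l%:E) _).1 ?ltry//.
exact: cvg_comp Tl _.
Qed.

Lemma intg_cst0 (R : realType) : intg (fun _ : R * R => (0 : R)) = 0.
Proof. by rewrite /Rintegral integral0. Qed.

(** * Gaussian moments of |f|^2, for f = u + i v with derivative p + i q *)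

Section energy_identities.
Variables (R : realType) (u v p q : R * R -> R).
Hypotheses (Cu : C1 u p (fun z => - q z)) (Cv : C1 v q p).

Let S z := u z ^+ 2 + v z ^+ 2.
Let G z := p z ^+ 2 + q z ^+ 2.
Let Sx z := 2 * (u z * p z + v z * q z).
Let Sy z := 2 * (v z * p z - u z * q z).
Let rho := @gauss_weight R.

Hypotheses (iS : ible (fun z => S z * rho z)) (iG : ible (fun z => G z * rho z)).

Let CS : C1 S Sx Sy.
Proof.
apply: (C1_eq (C1D (C1M Cu Cu) (C1M Cv Cv))) => z; rewrite /S /Sx /Sy; ring.
Qed.

Let rho_ge0 z : 0 <= rho z.
Proof. by rewrite mulr_ge0 ?expR_ge0// invr_ge0 pi_ge0. Qed.

Let S_ge0 z : 0 <= S z. Proof. by rewrite addr_ge0 ?sqr_ge0. Qed.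
Let G_ge0 z : 0 <= G z. Proof. by rewrite addr_ge0 ?sqr_ge0. Qed.

Let Sx_le z : `|Sx z| <= S z + G z.
Proof.
rewrite ler_norml /Sx /S /G; apply/andP; split; rewrite -subr_ge0.
  have -> : forall a b c d : R, 2 * (a * c + b * d) - - (a ^+ 2 + b ^+ 2 +
    (c ^+ 2 + d ^+ 2)) = (a + c) ^+ 2 + (b + d) ^+ 2 by move=> *; ring.
  by rewrite addr_ge0 ?sqr_ge0.
have -> : forall a b c d : R, a ^+ 2 + b ^+ 2 + (c ^+ 2 + d ^+ 2)
  - 2 * (a * c + b * d) = (a - c) ^+ 2 + (b - d) ^+ 2 by move=> *; ring.
by rewrite addr_ge0 ?sqr_ge0.
Qed.

Let Sy_le z : `|Sy z| <= S z + G z.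
Proof.
rewrite ler_norml /Sy /S /G; apply/andP; split; rewrite -subr_ge0.
  have -> : forall a b c d : R, 2 * (b * c - a * d) - - (a ^+ 2 + b ^+ 2 +
    (c ^+ 2 + d ^+ 2)) = (a - d) ^+ 2 + (b + c) ^+ 2 by move=> *; ring.
  by rewrite addr_ge0 ?sqr_ge0.
have -> : forall a b c d : R, a ^+ 2 + b ^+ 2 + (c ^+ 2 + d ^+ 2)
  - 2 * (b * c - a * d) = (a + d) ^+ 2 + (b - c) ^+ 2 by move=> *; ring.
by rewrite addr_ge0 ?sqr_ge0.
Qed.

Let kap n z := cutoff n z * rho z.
Let kapx n z := cutoff n z * (- 2 * z.1 * rho z) + cutoffx n z * rho z.
Let kapy n z := cutoff n z * (- 2 * z.2 * rho z) + cutoffy n z * rho z.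

Let Ckap n : C1 (kap n) (kapx n) (kapy n).
Proof. exact: C1M (C1_cutoff R n) (C1_gauss R). Qed.

Let kap0 n z : ~ box n.+1%:R z -> [/\ kap n z = 0, kapx n z = 0 & kapy n z = 0].
Proof.
by rewrite /kap /kapx /kapy => /cutoff_outside[-> -> ->]; rewrite !mul0r addr0.
Qed.

Let dxSk n : [/\ ible (fun z => kap n z * Sx z + kapx n z * S z),
  ible (fun z => kap n z * Sy z + kapy n z * S z),
  intg (fun z => kap n z * Sx z + kapx n z * S z) = 0 &
  intg (fun z => kap n z * Sy z + kapy n z * S z) = 0].
Proof.
apply: (C1_intg0 (M := n.+1%:R) (C1M (Ckap n) CS)) => z /kap0[-> -> ->].
by rewrite !mul0r addr0.
Qed.

(* The terms in which the cutoff is differentiated. *)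
Let remainder n z := S z * (z.1 * cutoffx n z + z.2 * cutoffy n z) / 2
  + (Sx z * cutoffx n z + Sy z * cutoffy n z) / 4.

(* Half the sum of the divergence of [kap S (x, y)] and of the weak form of
   [Delta S = 4 G] tested against [kap]: the terms in [x Sx + y Sy] cancel. *)
Let flux n : [/\ ible (fun z => cutoff n z * (nsq z * S z * rho z)),
  ible (fun z => (cutoff n z * (S z + G z) + remainder n z) * rho z) &
  intg (fun z => cutoff n z * (nsq z * S z * rho z)) =
  intg (fun z => (cutoff n z * (S z + G z) + remainder n z) * rho z)].
Proof.
have CR := C1_cutoff R n.
have out0 z : ~ box n.+1%:R z -> [/\ kap n z = 0, kapx n z = 0 & kapy n z = 0].
  exact: kap0.
have [|I1 _ E1 _] := C1_intg0 (M := n.+1%:R) (C1M (C1M (C1_fst R) (Ckap n)) CS).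
  by move=> z /out0[-> -> ->]; rewrite !(mul0r, mulr0, addr0).
have [|_ I2 _ E2] := C1_intg0 (M := n.+1%:R) (C1M (C1M (C1_snd R) (Ckap n)) CS).
  by move=> z /out0[-> -> ->]; rewrite !(mul0r, mulr0, addr0).
have Cku := C1M (Ckap n) Cu; have Ckv := C1M (Ckap n) Cv.
have E3 := weak_Cauchy_Riemann (M := n.+1%:R) Cu Cv Cku.
(* The same identity for - i f = v - i u, whose derivative is q - i p: it supplies the other
   Cauchy-Riemann equation, q_x = - p_y. *)
have E4 := weak_Cauchy_Riemann (M := n.+1%:R) (u := v) (v := fun z => - u z)
  (p := q) (q := fun z => - p z).
have cu := C1_continuous Cu; have cv := C1_continuous Cv.
have cp : continuous p by case: Cv.
have cq : continuous q by case: Cv.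
have [cS cSx cSy _ _] := CS.
have [cw cwx cwy _ _] := CR.
have [ck ckx cky _ _] := Ckap n.
have cr : continuous rho := C1_continuous (C1_gauss R).
have cn := C1_continuous (@C1_nsq R).
pose A3 z := (kap n z * p z + kapx n z * u z) * p z
   - (kap n z * - q z + kapy n z * u z) * q z.
pose A4 z := (kap n z * q z + kapx n z * v z) * q z
   - (kap n z * p z + kapy n z * v z) * - p z.
have I3 : ible A3.
  apply: (box_integrable (M := n.+1%:R)); first by rewrite /A3; cts.
  by move=> z /out0[]; rewrite /A3 => -> -> ->; ring.
have I4 : ible A4.
  apply: (box_integrable (M := n.+1%:R)); first by rewrite /A4; cts.
  by move=> z /out0[]; rewrite /A4 => -> -> ->; ring.
have E3' : intg A3 = 0.
  apply: E3 => z /out0[-> -> ->]; split; ring.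
have E4' : intg A4 = 0.
  apply: (E4 _ _ _ _ _ Ckv).
  - by apply: (C1_eq Cv) => // z; rewrite opprK.
  - by apply: (C1_eq (C1N Cu)) => // z; rewrite opprK.
  - move=> z /out0[-> -> ->]; split; ring.
pose A1 z := z.1 * kap n z * Sx z + (z.1 * kapx n z + 1 * kap n z) * S z.
pose A2 z := z.2 * kap n z * Sy z + (z.2 * kapy n z + 1 * kap n z) * S z.
pose T z := cutoff n z * (nsq z * S z * rho z).
pose P z := (cutoff n z * (S z + G z) + remainder n z) * rho z.
have {}I1 : ible A1 by []. have {}I2 : ible A2 by [].
have {}E1 : intg A1 = 0 by []. have {}E2 : intg A2 = 0 by [].
have IT : ible T.
  apply: (box_integrable (M := n.+1%:R)); first by rewrite /T; cts.
  by move=> z /cutoff_outside[]; rewrite /T => -> _ _; rewrite mul0r.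
have IP : ible P.
  apply: (box_integrable (M := n.+1%:R)); first by rewrite /P /remainder /G; cts.
  by move=> z /cutoff_outside[]; rewrite /P /remainder => -> -> ->; ring.
split => //; change (intg T = intg P).
have PT : (fun z => 2 * (P z - T z)) = (fun z => A1 z + A2 z + (A3 z + A4 z)).
  apply/funext => z; rewrite /P /T /A1 /A2 /A3 /A4 /remainder /kap /kapx /kapy.
  rewrite /Sx /Sy /S /G /nsq.
  move: (cutoff n z) (cutoffx n z) (cutoffy n z) (rho z) (u z) (v z) (p z) (q z).
  by move: z.1 z.2 => *; field.
have := congr1 (fun f => intg f) PT => /=.
rewrite (intgZ 2 (ibleB IP IT)) (intgB IP IT).
rewrite (intgD (ibleD I1 I2) (ibleD I3 I4)) (intgD I1 I2) (intgD I3 I4).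
rewrite E1 E2 E3' E4'.
move: (intg P) (intg T) => a b H; lra.
Qed.

Let cS : continuous S := C1_continuous CS.
Let cSx : continuous Sx. Proof. by case: CS. Qed.
Let cSy : continuous Sy. Proof. by case: CS. Qed.
Let cG : continuous G.
Proof.
have cp : continuous p by case: Cv.
have cq : continuous q by case: Cv.
rewrite /G; cts.
Qed.
Let cr : continuous rho := C1_continuous (C1_gauss R).
Let cn : continuous (@nsq R) := C1_continuous (@C1_nsq R).
Let cw n : continuous (@cutoff R n) := C1_continuous (C1_cutoff R n).
Let cwx n : continuous (@cutoffx R n). Proof. by case: (C1_cutoff R n). Qed.
Let cwy n : continuous (@cutoffy R n). Proof. by case: (C1_cutoff R n). Qed.

Let SG z := (S z + G z) * rho z.
Let iSG : ible SG.
Proof.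
rewrite (_ : SG = fun z => S z * rho z + G z * rho z); first exact: ibleD.
by apply/funext => z; rewrite /SG mulrDl.
Qed.

(** The bound does not involve |z|^2 |f|^2. The constant is 2 / 2 from the radial derivative plus (4
    + 4) / 4 from the two partial derivatives of the cutoff. *)
Let remainder_le n z : `|remainder n z| <= 3 * (S z + G z).
Proof.
have SG0 : 0 <= S z + G z by rewrite addr_ge0.
have H1 : `|S z * (z.1 * cutoffx n z + z.2 * cutoffy n z)| <= (S z + G z) * 2.
  by rewrite normrM ler_pM// ?cutoff_radial_le// ger0_norm// lerDl.
have H2 : `|Sx z * cutoffx n z| <= (S z + G z) * 4.
  by rewrite normrM ler_pM// cutoffx_le.
have H3 : `|Sy z * cutoffy n z| <= (S z + G z) * 4.
  by rewrite normrM ler_pM// cutoffy_le.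
move: H1 H2 H3; rewrite /remainder.
move: (S z * _) (Sx z * _) (Sy z * _) (S z + G z) SG0 => a b c d d0.
rewrite !ler_norml => /andP[? ?] /andP[? ?] /andP[? ?]; apply/andP; split; lra.
Qed.

(** The other side of [flux] is dominated by [4 * SG], so the truncated second moments converge to a
    finite limit before the full second moment is known to exist. *)
Let flux_cvg : intg (fun z => cutoff n z * (nsq z * S z * rho z)) @[n --> \oo]
  --> intg SG.
Proof.
have [|||||_ cP] := @intg_dominated R
    (fun n z => (cutoff n z * (S z + G z) + remainder n z) * rho z) SG
    (fun z => 4 * SG z).
- by move=> n; have := cw (n := n); have := cwx (n := n); have := cwy (n := n);
    move=> ? ? ?; rewrite /remainder; cbv beta; cts.
- by rewrite /SG; cts.
- exact: ibleZ.
- move=> z; apply: cvgM; last exact: cvg_cst.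
  rewrite -[X in _ --> X]addr0 -{2}[S z + G z]mul1r; apply: cvgD.
    by apply: cvgM; [exact: cutoff_cvg|exact: cvg_cst].
  rewrite (_ : 0 = S z * (z.1 * 0 + z.2 * 0) / 2 + (Sx z * 0 + Sy z * 0) / 4);
    last by rewrite !mulr0 !addr0 mulr0 !mul0r addr0.
  by apply: cvgD; apply: cvgM; (try exact: cvg_cst); [apply: cvgM; [exact: cvg_cst|]|];
    apply: cvgD; apply: cvgM; (exact: cvg_cst || exact: cutoffx_cvg || exact: cutoffy_cvg).
- move=> n z; rewrite normrM (ger0_norm (rho_ge0 z)) /SG mulrA ler_wpM2r//.
  rewrite (le_trans (ler_normD _ _))// (_ : 4 = 1 + 3); last by ring.
  have SG0 : 0 <= S z + G z by rewrite addr_ge0.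
  rewrite mulrDl lerD ?remainder_le// normrM (ger0_norm SG0) ler_wpM2r//.
  by rewrite ger0_norm ?cutoff_ge0// cutoff_le1.
rewrite (_ : (fun n => _) = (fun n =>
  intg (fun z => (cutoff n z * (S z + G z) + remainder n z) * rho z)))//.
by apply/funext => n; have [] := flux n.
Qed.

Let cT n : continuous (fun z => cutoff n z * (nsq z * S z * rho z)).
Proof. by have := cw (n := n) => ?; cts. Qed.

Let T_cvg z : cutoff n z * (nsq z * S z * rho z) @[n --> \oo] --> nsq z * S z * rho z.
Proof.
rewrite -[X in _ --> X]mul1r.
by apply: cvgM; [exact: cutoff_cvg|exact: cvg_cst].
Qed.

Let nsqS_ge0 z : 0 <= nsq z * S z * rho z.
Proof. by rewrite mulr_ge0// mulr_ge0// nsq_ge0. Qed.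

Let cnS : continuous (fun z => nsq z * S z * rho z). Proof. by cts. Qed.

(** The truncated second moments are nonnegative with convergent integrals, so Fatou's lemma
    applies. This is the square integrability of [z f]. *)
Lemma ible_nsq : ible (fun z => nsq z * S z * rho z).
Proof.
apply: (ge0_cvg_ible cT _ _ _ _ flux_cvg) => //.
- by move=> n z; rewrite mulr_ge0// cutoff_ge0.
- by move=> n; have [] := flux n.
Qed.

(** Once integrable, the second moment dominates its own truncations; the limit of their integrals
    is then computed in two ways. In terms of f this reads ||z f||^2 = ||f||^2 + ||f'||^2. *)
Lemma intg_nsq : intg (fun z => nsq z * S z * rho z) =
  intg (fun z => S z * rho z) + intg (fun z => G z * rho z).
Proof.
have [|_ cI] := @intg_dominated R
    (fun n z => cutoff n z * (nsq z * S z * rho z)) _ _ cT cnS ible_nsq T_cvg.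
  move=> n z; rewrite normrM (ger0_norm (cutoff_ge0 _ _)) ger0_norm//.
  by rewrite ler_piMl// cutoff_le1.
rewrite -intgD//; transitivity (intg SG).
  exact: cvg_unique cI flux_cvg.
by congr (intg _); apply/funext => z; rewrite /SG mulrDl.
Qed.

(** Common to both coordinates: [c] is the coordinate, [Sd] the derivative of |f|^2 along it and
    [wc] that of the cutoff. The truncated identity says that a derivative of [kap * S] has integral
    0, and the factor 2 in the limit comes from differentiating the Gaussian weight. *)
Let first_moment (c : R * R -> R) (wc : nat -> R * R -> R) (Sd : R * R -> R) :
  continuous c -> (forall z, c z ^+ 2 <= nsq z) ->
  continuous Sd -> (forall z, `|Sd z| <= S z + G z) ->
  (forall n, continuous (wc n)) ->
  (forall n z, `|wc n z| <= 4) -> (forall z, wc n z @[n --> \oo] --> (0 : R)) ->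
  (forall n, intg (fun z => kap n z * Sd z +
     (cutoff n z * (- 2 * c z * rho z) + wc n z * rho z) * S z) = 0) ->
  intg (fun z => Sd z * rho z) = 2 * intg (fun z => c z * S z * rho z).
Proof.
move=> cc c_le cSd Sd_le cwc wc_le wc_cvg E0.
have c_nsq z : `|c z| <= 1 + nsq z.
  rewrite (le_trans _ (lerD (lexx 1) (c_le z)))//.
  rewrite -(real_normK (num_real (c z))); move: (`|c z|) => d.
  have := sqr_ge0 (d - 2^-1); rewrite -subr_ge0 => ?; rewrite -subr_ge0; nra.
have isd : ible (fun z => Sd z * rho z).
  apply: (ible_le _ iSG); first by cts.
  by move=> z; rewrite normrM (ger0_norm (rho_ge0 z)) ler_wpM2r.
have icS : ible (fun z => c z * S z * rho z).
  apply: (ible_le _ (ibleD iS ible_nsq)); first by cts.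
  move=> z; rewrite (normrM (c z * S z)) (normrM (c z)) (ger0_norm (rho_ge0 z)).
  rewrite (ger0_norm (S_ge0 z)).
  by rewrite -[X in X + _]mul1r mulrA -!mulrDl ler_wpM2r// ler_wpM2r.
(* The three dominating terms answer to the derivative of |f|^2, to that of the weight (through |c|
   <= 1 + |z|^2) and to that of the cutoff. *)
have [|||||_ cI] := @intg_dominated R
    (fun n z => kap n z * Sd z +
     (cutoff n z * (- 2 * c z * rho z) + wc n z * rho z) * S z)
    (fun z => Sd z * rho z - 2 * (c z * S z * rho z))
    (fun z => SG z + 2 * (S z * rho z + nsq z * S z * rho z) + 4 * (S z * rho z)).
- by move=> n; have := cw (n := n) => ?; have := cwc n => ?; rewrite /kap; cbv beta; cts.
- by cts.
- by apply: ibleD; [apply: ibleD => //; apply: ibleZ; apply: ibleD => //; exact: ible_nsq|exact: ibleZ].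
- move=> z.
  rewrite (_ : _ - _ = 1 * rho z * Sd z +
    (1 * (- 2 * c z * rho z) + 0 * rho z) * S z); last by ring.
  by apply: cvgD; apply: cvgM; rewrite ?/kap; (try exact: cvg_cst);
    [|apply: cvgD]; apply: cvgM; (exact: cvg_cst || exact: cutoff_cvg || exact: wc_cvg).
- move=> n z.
  have w0 := cutoff_ge0 n z; have w1 := cutoff_le1 n z.
  rewrite (le_trans (ler_normD _ _))//.
  have r0 := rho_ge0 z; have s0 := S_ge0 z.
  have k1 : `|kap n z| <= rho z.
    by rewrite /kap normrM (ger0_norm w0) (ger0_norm r0) ler_piMl.
  rewrite -addrA lerD//; first by rewrite normrM mulrC ler_pM.
  rewrite (_ : 2 * _ + 4 * _ = (rho z * (2 * (1 + nsq z)) + 4 * rho z) * S z);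
    last by ring.
  rewrite normrM (ger0_norm s0) ler_wpM2r// (le_trans (ler_normD _ _))// lerD//.
    rewrite (_ : cutoff n z * (- 2 * c z * rho z) = kap n z * (- (2 * c z)));
      last by rewrite /kap; ring.
    by rewrite normrM ler_pM// normrN normrM normr_nat ler_pM2l.
  by rewrite normrM (ger0_norm r0) ler_wpM2r.
have : intg (fun z => Sd z * rho z - 2 * (c z * S z * rho z)) = 0.
  apply: (cvg_unique (@Rhausdorff R) cI).
  rewrite (_ : (fun n => _) = cst 0); first exact: cvg_cst.
  by apply/funext => n; exact: E0.
rewrite (intgB isd (ibleZ 2 icS)) (intgZ 2 icS) => /eqP.
by rewrite subr_eq0 => /eqP.
Qed.

(** In terms of f: Re <f', f> = Re <z f, f>. *)
Lemma intg_fst : intg (fun z => (u z * p z + v z * q z) * rho z) =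
  intg (fun z => z.1 * S z * rho z).
Proof.
have [cu _ _ _ _] := Cu; have [cv cq cp _ _] := Cv.
have iE : ible (fun z => (u z * p z + v z * q z) * rho z).
  apply: (ible_le _ iSG); first by cts.
  move=> z; rewrite (normrM (_ + _)) (ger0_norm (rho_ge0 z)) ler_wpM2r//.
  apply: le_trans (Sx_le z); rewrite /Sx [leRHS]normrM normr_nat.
  by rewrite ler_peMl// ler1n.
have E : intg (fun z => Sx z * rho z) = 2 * intg (fun z => z.1 * S z * rho z).
  apply: (@first_moment (fun z => z.1) (fun n => @cutoffx R n) Sx) => //.
  - exact: continuous_fst2.
  - by move=> z; rewrite lerDl sqr_ge0.
  - exact: cutoffx_le.
  - exact: cutoffx_cvg.
  - by move=> n; have [_ _ E1 E2] := dxSk n; exact: E1.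
have n2 : (2 : R) != 0 by rewrite pnatr_eq0.
apply: (mulfI n2); rewrite -E -(intgZ 2 iE); congr (intg _); apply/funext => z.
by rewrite /Sx mulrA.
Qed.

(** In terms of f: - Im <f', f> = Im <z f, f>. With the real parts this gives <f', f> = <f, z f>. *)
Lemma intg_snd : intg (fun z => (v z * p z - u z * q z) * rho z) =
  intg (fun z => z.2 * S z * rho z).
Proof.
have [cu _ _ _ _] := Cu; have [cv cq cp _ _] := Cv.
have iE : ible (fun z => (v z * p z - u z * q z) * rho z).
  apply: (ible_le _ iSG); first by cts.
  move=> z; rewrite (normrM (_ + _)) (ger0_norm (rho_ge0 z)) ler_wpM2r//.
  apply: le_trans (Sy_le z); rewrite /Sy [leRHS]normrM normr_nat.
  by rewrite ler_peMl// ler1n.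
have E : intg (fun z => Sy z * rho z) = 2 * intg (fun z => z.2 * S z * rho z).
  apply: (@first_moment (fun z => z.2) (fun n => @cutoffy R n) Sy) => //.
  - exact: continuous_snd2.
  - by move=> z; rewrite lerDr sqr_ge0.
  - exact: cutoffy_le.
  - exact: cutoffy_cvg.
  - by move=> n; have [_ _ E1 E2] := dxSk n; exact: E2.
have n2 : (2 : R) != 0 by rewrite pnatr_eq0.
apply: (mulfI n2); rewrite -E -(intgZ 2 iE); congr (intg _); apply/funext => z.
by rewrite /Sy mulrA.
Qed.

End energy_identities.

Import ComplexField.Normc.

(** * Complex derivatives and Gaussians *)

Section complex_derivative.
Variable R : realType.
Implicit Types (f g : R[i] -> R[i]) (z h l : R[i]).

(** Differentiability in little-o form with the real-valued modulus: it admits h = 0 and turns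
    proofs into real estimates, away from the topology of [R[i]^o]. *)
Definition cdiff f z l := forall e : R, 0 < e -> exists2 d : R, 0 < d &
  forall h, normc h < d -> normc (f (z + h) - f z - h * l) <= e * normc h.

Lemma normcE z : `|z| = (normc z)%:C.
Proof. by rewrite normc_def; case: z. Qed.

Lemma normc_ge0 z : 0 <= normc z.
Proof. by case: z => a b; exact: sqrtr_ge0. Qed.

Lemma Re_le_normc z : `|complex.Re z| <= normc z.
Proof. by case: z => a b /=; rewrite -sqrtr_sqr ler_wsqrtr// lerDl sqr_ge0. Qed.

Lemma Im_le_normc z : `|complex.Im z| <= normc z.
Proof. by case: z => a b /=; rewrite -sqrtr_sqr ler_wsqrtr// lerDr sqr_ge0. Qed.

Lemma normc_le_ReIm z : normc z <= `|complex.Re z| + `|complex.Im z|.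
Proof.
case: z => a b /=; rewrite -[leRHS]ger0_norm ?addr_ge0// -sqrtr_sqr ler_wsqrtr//.
rewrite sqrrD !real_normK ?num_real// lerD2r lerDl.
by rewrite mulrn_wge0 ?mulr_ge0.
Qed.

Lemma ltr0c_ex (e : R[i]) : 0 < e -> exists2 r : R, 0 < r & e = r%:C.
Proof. by case: e => a b; rewrite ltcE/= => /andP[/eqP-> a0]; exists a. Qed.

Lemma cdiffP f z l : cdiff f z l <-> derivable (f : R[i]^o -> R[i]^o) z 1 /\ cderiv f z = l.
Proof.
have eqv : cdiff f z l <->
  (fun h : R[i]^o => h^-1 *: ((f : R[i]^o -> R[i]^o) (h *: 1 + z) - f z)) @ 0^' --> (l : R[i]^o).
  split.
    move=> fl; apply/cvgrPdist_le => e /ltr0c_ex[r r0 ->{e}].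
    have [d d0 H] := fl r r0.
    have d0' : 0 < d%:C by rewrite ltcR.
    near=> h.
    have h0 : h != 0 by near: h; exact: nbhs_dnbhs_neq.
    have hd : normc h < d.
      rewrite -ltcR -normcE; near: h; apply: cvg_within.
      apply/nbhs_ballP; exists d%:C => //= h.
      by rewrite -ball_normE /ball_/= sub0r normrN.
    have -> : l - h^-1 *: (f (h *: 1 + z) - f z) =
        - (h^-1 * (f (z + h) - f z - h * l)).
      by rewrite /GRing.scale/= mulr1 [h + z]addrC; field.
    rewrite normrN normrM normrV ?unitfE// ler_pdivrMl ?normr_gt0// [_ * _%:C]mulrC.
    by rewrite !normcE -rmorphM lecR; exact: H.
  move=> /cvgrPdist_le fl e e0.
  have e0' : 0 < e%:C by rewrite ltcR.
  have := fl _ e0'; rewrite near_withinE => /nbhs_ballP[d /= /ltr0c_ex[r r0 ->] H].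
  exists r => // h hr; have [->|h0] := eqVneq h 0.
    by rewrite addr0 mul0r subrr subr0 normc0 mulr0.
  have /(_ _ h0) := H h _.
  rewrite -ball_normE /ball_/= sub0r normrN normcE ltcR => /(_ hr).
  have -> : l - h^-1 *: (f (h *: 1 + z) - f z) =
        - (h^-1 * (f (z + h) - f z - h * l)).
    by rewrite /GRing.scale/= mulr1 [h + z]addrC; field.
  rewrite normrN normrM normrV ?unitfE// ler_pdivrMl ?normr_gt0// [_ * _%:C]mulrC.
  by rewrite !normcE -rmorphM lecR.
rewrite eqv; split.
  move=> H; split; first by apply/cvg_ex; eexists; exact: H.
  rewrite /cderiv derive1E /derive; have := cvg_lim (@norm_hausdorff _ _) H; apply.
move=> [/cvg_ex[/= m H] <-].
have L := cvg_lim (@norm_hausdorff _ _) H.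
rewrite /cderiv derive1E /derive L; exact: H.
Unshelve. all: end_near. Qed.

Lemma is_derive_eps (g : R -> R) (x l : R) :
  (forall e : R, 0 < e -> exists2 d : R, 0 < d &
    forall h : R, `|h| < d -> `|g (x + h) - g x - h * l| <= e * `|h|) ->
  is_derive x (1 : R) g l.
Proof.
move=> gl.
have H : h^-1 *: (g (h *: 1 + x) - g x) @[h --> (0 : R)^'] --> l.
  apply/cvgrPdist_le => e e0; have [d d0 H] := gl e e0.
  near=> h.
  have h0 : h != 0 by near: h; exact: nbhs_dnbhs_neq.
  have hd : `|h| < d.
    near: h; apply: cvg_within; apply/nbhs_ballP; exists d => //= h.
    by rewrite /ball/= sub0r normrN.
  have -> : l - h^-1 *: (g (h *: 1 + x) - g x) = - (h^-1 * (g (x + h) - g x - h * l)).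
    by rewrite /GRing.scale/= mulr1 [h + x]addrC; field.
  by rewrite normrN normrM normrV ?unitfE// ler_pdivrMl ?normr_gt0// [_ * e]mulrC H.
split; last by apply: cvg_lim => //.
by apply/cvg_ex; eexists; exact: H.
Unshelve. all: end_near. Qed.

(** Increments are restricted to real and to purely imaginary ones; the Cauchy-Riemann equations are
    built into the four values. *)
Lemma cdiff_partials f l (x y : R) : cdiff f (x +i* y) l ->
  [/\ is_derive x (1 : R) (fun s => complex.Re (f (s +i* y))) (complex.Re l),
     is_derive x (1 : R) (fun s => complex.Im (f (s +i* y))) (complex.Im l),
     is_derive y (1 : R) (fun t => complex.Re (f (x +i* t))) (- complex.Im l) &
     is_derive y (1 : R) (fun t => complex.Im (f (x +i* t))) (complex.Re l)].
Proof.
move=> fl.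
have nr (h : R) : normc (h +i* 0) = `|h| by rewrite /= expr0n addr0 sqrtr_sqr.
have ni (h : R) : normc (0 +i* h) = `|h| by rewrite /= expr0n add0r sqrtr_sqr.
have er (h : R) : (x +i* y) + (h +i* 0) = (x + h) +i* y :> R[i].
  by apply/eqP; rewrite eq_complex /= addr0 !eqxx.
have ei (h : R) : (x +i* y) + (0 +i* h) = x +i* (y + h) :> R[i].
  by apply/eqP; rewrite eq_complex /= addr0 !eqxx.
by split; apply: is_derive_eps => e e0; have [d d0 H] := fl e e0;
  exists d => // h hd;
  [have := H (h +i* 0) | have := H (h +i* 0) | have := H (0 +i* h) | have := H (0 +i* h)];
  rewrite ?nr ?ni ?er ?ei => /(_ hd);
  [apply: le_trans; apply: le_trans (Re_le_normc _)
  |apply: le_trans; apply: le_trans (Im_le_normc _)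
  |apply: le_trans; apply: le_trans (Re_le_normc _)
  |apply: le_trans; apply: le_trans (Im_le_normc _)];
  move: (f _) (f _) l {fl H} => [? ?] [? ?] [? ?] /=;
  rewrite le_eqVlt; apply/orP; left; apply/eqP; congr (Num.norm _); ring.
Qed.

Lemma cdiff_lipschitz f z l : cdiff f z l -> exists2 d : R, 0 < d &
  forall h, normc h < d -> normc (f (z + h) - f z) <= (1 + normc l) * normc h.
Proof.
move=> /(_ 1 ltr01)[d d0 H]; exists d => // h hd.
rewrite -[_ - f z](subrK (h * l)) (le_trans (le_normcD _ _))// mulrDl.
by rewrite lerD ?H// normcM mulrC.
Qed.

Lemma cdiff_continuous f : (forall z, exists l, cdiff f z l) ->
  continuous (fun p : R * R => complex.Re (at_point f p)) /\
  continuous (fun p : R * R => complex.Im (at_point f p)).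
Proof.
move=> df.
have K (p : R * R) (e : R) : 0 < e -> \forall q \near p, normc (at_point f q - at_point f p) <= e.
  move=> e0; have [l /cdiff_lipschitz[d d0 H]] := df (p.1 +i* p.2).
  have l0 : 0 < 1 + normc l by rewrite ltr_pwDl// normc_ge0.
  (* Balls of the product are squares, so the complex increment has modulus at most [2 * r]; the
     halves compensate for this. *)
  pose r := Num.min (d / 2) (e / (1 + normc l) / 2).
  have r0 : 0 < r by rewrite lt_min !divr_gt0.
  apply/nbhs_ballP; exists r => // -[x y] [/=].
  rewrite /ball/= => xr yr.
  pose h : R[i] := (x - p.1) +i* (y - p.2).
  have hr : normc h <= 2 * r.
    apply: le_trans (normc_le_ReIm h) _ => /=.
    by rewrite mulr2n mulrDl mul1r lerD// distrC ltW.
  have hd : normc h < d.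
    apply: le_lt_trans (normc_le_ReIm h) _ => /=.
    have rd : r <= d / 2 by rewrite ge_min lexx.
    have : `|x - p.1| + `|y - p.2| < r + r by rewrite ltrD// distrC.
    by move=> /lt_le_trans; apply; lra.
  have := H _ hd.
  have -> : (p.1 +i* p.2) + h = x +i* y.
    by apply/eqP; rewrite eq_complex /= !subrKC !eqxx.
  move=> /le_trans; apply; rewrite mulrC -ler_pdivlMr//.
  have re : r <= e / (1 + normc l) / 2 by rewrite ge_min lexx orbT.
  by apply: le_trans hr _; lra.
split=> p; apply/cvgrPdist_le => e /(K p); apply: filterS => q Kq.
  apply: le_trans Kq; rewrite distrC.
  by apply: le_trans (Re_le_normc _); move: (at_point f q) (at_point f p) => [? ?] [? ?].
apply: le_trans Kq; rewrite distrC.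
by apply: le_trans (Im_le_normc _); move: (at_point f q) (at_point f p) => [? ?] [? ?].
Qed.

Lemma cdiffM f g z l m : cdiff f z l -> cdiff g z m ->
  cdiff (fun w => f w * g w) z (f z * m + g z * l).
Proof.
move=> /cdiffP[df <-] /cdiffP[dg <-]; apply/cdiffP; split.
  exact: (@derivableM (R[i] : numFieldType) (R[i]^o : normedModType R[i]) f g z 1 df dg).
rewrite /cderiv !derive1E.
exact: (@deriveM (R[i] : numFieldType) (R[i]^o : normedModType R[i]) f g z 1 df dg).
Qed.

End complex_derivative.

(** * The complex exponential and first order linear equations *)

Section complex_exponential.
Variable R : realType.
Implicit Types (f g : R[i] -> R[i]) (z w h l m : R[i]).

Lemma is_derive_littleo (g : R -> R) (x l : R) : is_derive x (1 : R) g l ->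
  forall e : R, 0 < e -> exists2 d : R, 0 < d &
    forall h : R, `|h| < d -> `|g (x + h) - g x - h * l| <= e * `|h|.
Proof.
move=> [/cvg_ex[/= k H] kl] e e0.
have {kl}E : k = l by rewrite -kl; apply/esym; exact: cvg_lim H.
move: H => /cvgrPdist_le/(_ e e0); rewrite near_withinE => /nbhs_ballP[d /= d0 H].
exists d => // h hd; have [->|h0] := eqVneq h 0.
  by rewrite addr0 mul0r subrr subr0 normr0 mulr0.
have := H h _ h0; rewrite /ball/= sub0r normrN => /(_ hd).
have -> : k - h^-1 *: (g (h *: 1 + x) - g x) = - (h^-1 * (g (x + h) - g x - h * l)).
  by rewrite E /GRing.scale/= mulr1 [h + x]addrC; field.
by rewrite normrN normrM normrV ?unitfE// ler_pdivrMl ?normr_gt0// [_ * e]mulrC.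
Qed.

Lemma cexpD z w : cexp (z + w) = cexp z * cexp w.
Proof.
case: z w => a b [c d]; rewrite /cexp /= expRD cosD sinD.
by apply/eqP; rewrite eq_complex /=; apply/andP; split; apply/eqP; ring.
Qed.

Lemma cexp0 : cexp (0 : R[i]) = 1.
Proof.
rewrite /cexp /= expR0 cos0 sin0.
by apply/eqP; rewrite eq_complex /=; apply/andP; split; apply/eqP; ring.
Qed.

Lemma normc_cexp z : normc (cexp z) = expR (complex.Re z).
Proof.
rewrite /cexp normcM /= expr0n addr0 sqrtr_sqr cos2Dsin2 sqrtr1 mulr1.
by rewrite ger0_norm ?expR_ge0.
Qed.

Lemma cdiff_cexp0 : cdiff (@cexp R) 0 1.
Proof.
(* The real and imaginary errors add up to at most r |a| + 5 r |b|, whence e / 6. The later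
   requirement |a| < r / 2 gives |exp a - 1| <= 2 |a| <= r. *)
move=> e e0; pose r := Num.min (e / 6) 1.
have r0 : 0 < r by rewrite lt_min divr_gt0 ?ltr01.
have r1 : r <= 1 by rewrite ge_min lexx orbT.
have re : r <= e / 6 by rewrite ge_min lexx.
have [d1 d10 H1] := is_derive_littleo (is_derive_expR 0) r0.
have [d2 d20 H2] := is_derive_littleo (is_derive_cos 0) r0.
have [d3 d30 H3] := is_derive_littleo (is_derive_sin 0) r0.
pose d := Num.min (Num.min d1 d2) (Num.min d3 (r / 2)).
exists d; first by rewrite !lt_min d10 d20 d30 divr_gt0.
move=> [a b] hd; rewrite add0r cexp0 mulr1.
have ha : `|a| < d by apply: le_lt_trans hd; exact: (Re_le_normc (a +i* b)).
have hb : `|b| < d by apply: le_lt_trans hd; exact: (Im_le_normc (a +i* b)).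
have := ha; rewrite /d !lt_min => /andP[/andP[a1 _] /andP[_ a4]].
have := hb; rewrite /d !lt_min => /andP[/andP[_ b2] /andP[b3 _]].
have := H1 _ a1; rewrite add0r expR0 mulr1 => E1.
have := H2 _ b2; rewrite add0r cos0 sin0 oppr0 mulr0 subr0 => E2.
have := H3 _ b3; rewrite add0r sin0 cos0 mulr1 subr0 => E3.
apply: le_trans (normc_le_ReIm _) _.
have Ha := Re_le_normc (a +i* b); have Hb := Im_le_normc (a +i* b).
move: (normc _) Ha Hb => N /= Ha Hb.
have -> : expR a * cos b - 0 * sin b - 1 - a =
  (expR a - 1 - a) + expR a * (cos b - 1) by ring.
have -> : expR a * sin b + 0 * cos b - 0 - b =
  expR a * (sin b - b) + (expR a - 1) * b by ring.
have x2 : expR a <= 2.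
  move: E1 a4; rewrite !ler_norml => /andP[_ E1] a4.
  have := ler_norm a => a5.
  have : r * `|a| <= 1 * `|a| by rewrite ler_wpM2r.
  by lra.
have x1 : `|expR a - 1| <= r.
  rewrite -[expR a - 1](subrK a) (le_trans (ler_normD _ _))//.
  have : r * `|a| <= 1 * `|a| by rewrite ler_wpM2r.
  by lra.
have y1 : `|expR a * (cos b - 1)| <= 2 * (r * `|b|).
  by rewrite normrM ler_pM// ger0_norm ?expR_ge0.
have y2 : `|expR a * (sin b - b)| <= 2 * (r * `|b|).
  by rewrite normrM ler_pM// ger0_norm ?expR_ge0.
have y3 : `|(expR a - 1) * b| <= r * `|b| by rewrite normrM ler_wpM2r.
have t1 := ler_normD (expR a - 1 - a) (expR a * (cos b - 1)).
have t2 := ler_normD (expR a * (sin b - b)) ((expR a - 1) * b).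
have u1 : r * `|a| <= e / 6 * N by rewrite ler_pM// ltW.
have u2 : r * `|b| <= e / 6 * N by rewrite ler_pM// ltW.
by lra.
Qed.

(** The addition law transports the derivative at 0; the tolerance is divided by the modulus of
    [cexp z]. *)
Lemma cdiff_cexp z : cdiff (@cexp R) z (cexp z).
Proof.
move=> e e0; have c0 : 0 < normc (cexp z) by rewrite normc_cexp expR_gt0.
have [d d0 H] := cdiff_cexp0 (divr_gt0 e0 c0); exists d => // h hd.
have := H h hd; rewrite add0r cexp0 mulr1 mulrAC ler_pdivlMr//.
rewrite -normcM cexpD; congr (normc _ <= _); ring.
Qed.

Lemma cdiff_comp f g z l m : cdiff g z m -> cdiff f (g z) l ->
  cdiff (fun w => f (g w)) z (m * l).
Proof.
move=> gm fl e e0.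
(* Adding 1 keeps the divisors positive when a derivative is zero. *)
have m0 : 0 < 1 + normc m by rewrite ltr_pwDl// normc_ge0.
have l0 : 0 < 1 + normc l by rewrite ltr_pwDl// normc_ge0.
have e1 : 0 < e / 2 / (1 + normc m) by rewrite !divr_gt0.
have e2 : 0 < e / 2 / (1 + normc l) by rewrite !divr_gt0.
have [d1 d10 H1] := fl _ e1.
have [d2 d20 H2] := gm _ e2.
have [d3 d30 H3] := cdiff_lipschitz gm.
exists (Num.min (Num.min d2 d3) (d1 / (1 + normc m))).
  by rewrite !lt_min d20 d30 divr_gt0.
move=> h; rewrite !lt_min => /andP[/andP[h2 h3]]; rewrite ltr_pdivlMr// => h1.
pose k := g (z + h) - g z.
have k1 : normc k <= (1 + normc m) * normc h by exact: H3.
have := H1 k (le_lt_trans k1 _); rewrite mulrC => /(_ h1).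
have -> : g z + k = g (z + h) by rewrite /k addrC subrK.
move=> K1; have K2 := H2 h h2.
have -> : f (g (z + h)) - f (g z) - h * (m * l) =
  (f (g (z + h)) - f (g z) - k * l) + l * (g (z + h) - g z - h * m).
  by rewrite /k; ring.
apply: le_trans (le_normcD _ _) _.
have -> : e * normc h = e / 2 * normc h + e / 2 * normc h by field.
apply: lerD.
  apply: le_trans K1 _; apply: le_trans (ler_wpM2l (ltW e1) k1) _.
  by rewrite mulrA divfK ?gt_eqF.
rewrite normcM; apply: le_trans (ler_wpM2l (normc_ge0 _) K2) _.
rewrite mulrA ler_wpM2r ?normc_ge0// mulrA ler_pdivrMr// [normc l * _]mulrC.
by rewrite ler_wpM2l ?divr_ge0 ?ltW// ltrDr.
Qed.

Lemma cdiff_id z : cdiff (fun w => w) z 1.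
Proof.
move=> e e0; exists 1 => // h _.
by rewrite mulr1 [z + h]addrC addrK subrr normc0 mulr_ge0 ?normc_ge0 ?ltW.
Qed.

Lemma cdiff_cst c z : cdiff (fun=> c) z 0.
Proof.
move=> e e0; exists 1 => // h _.
by rewrite mulr0 !subrr normc0 mulr_ge0 ?normc_ge0 ?ltW.
Qed.

Lemma cdiffD f g z l m : cdiff f z l -> cdiff g z m ->
  cdiff (fun w => f w + g w) z (l + m).
Proof.
move=> fl gm e e0; have e2 : 0 < e / 2 by rewrite divr_gt0.
have [d1 d10 H1] := fl _ e2; have [d2 d20 H2] := gm _ e2.
exists (Num.min d1 d2); first by rewrite lt_min d10.
move=> h; rewrite lt_min => /andP[h1 h2].
have := H1 h h1; have := H2 h h2 => E2 E1.
have -> : f (z + h) + g (z + h) - (f z + g z) - h * (l + m) =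
  (f (z + h) - f z - h * l) + (g (z + h) - g z - h * m) by ring.
by apply: le_trans (le_normcD _ _) _; lra.
Qed.

Definition gaussian (a b : R[i]) : R[i] -> R[i] := fun z => cexp (a * z ^+ 2 + b * z).

Lemma cdiff_gaussian a b z :
  cdiff (gaussian a b) z ((2 * a * z + b) * gaussian a b z).
Proof.
apply: cdiff_comp; last exact: cdiff_cexp.
have E := cdiffD (cdiffM (cdiff_cst a z) (cdiffM (cdiff_id z) (cdiff_id z)))
  (cdiffM (cdiff_cst b z) (cdiff_id z)).
have -> : 2 * a * z + b = a * (z * 1 + z * 1) + z * z * 0 + (b * 1 + z * 0) by ring.
exact: E.
Qed.

Lemma gaussianN a b z : gaussian (- a) (- b) z * gaussian a b z = 1.
Proof. by rewrite /gaussian -cexpD -cexp0; congr cexp; ring. Qed.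

Lemma cdiff_eq f z l m : cdiff f z l -> l = m -> cdiff f z m.
Proof. by move=> + <-. Qed.

Lemma cdiff0_cst f : (forall z, cdiff f z 0) -> forall z, f z = f 0.
Proof.
move=> f0 [x y].
have H1 s t : f (s +i* t) = f (0 +i* t).
  have [H _ _ _] := cdiff_partials (f0 (0 +i* 0)).
  apply/eqP; rewrite eq_complex; apply/andP; split; apply/eqP.
    apply: (@is_derive_0_is_cst _ (fun s => complex.Re (f (s +i* t)))) => s'.
    by have [] := cdiff_partials (f0 (s' +i* t)).
  apply: (@is_derive_0_is_cst _ (fun s => complex.Im (f (s +i* t)))) => s'.
  by have [] := cdiff_partials (f0 (s' +i* t)).
rewrite H1.
apply/eqP; rewrite eq_complex; apply/andP; split; apply/eqP.
  apply: (@is_derive_0_is_cst _ (fun t => complex.Re (f (0 +i* t)))) => t'.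
  by have [_ _ + _] := cdiff_partials (f0 (0 +i* t')); rewrite /= oppr0.
apply: (@is_derive_0_is_cst _ (fun t => complex.Im (f (0 +i* t)))) => t'.
by have [_ _ _] := cdiff_partials (f0 (0 +i* t')).
Qed.

(** The inverse Gaussian is an integrating factor: its product with [f] has zero derivative, hence
    is constant. *)
Lemma gaussian_ode f a b :
  (forall z, cdiff f z ((2 * a * z + b) * f z)) ->
  exists C, f =1 fun z => C * gaussian a b z.
Proof.
move=> df.
have H z : cdiff (fun w => f w * gaussian (- a) (- b) w) z 0.
  apply: (cdiff_eq (cdiffM (df z) (cdiff_gaussian (- a) (- b) z))); ring.
exists (f 0 * gaussian (- a) (- b) 0) => z.
by rewrite -(cdiff0_cst H z) -mulrA gaussianN mulr1.
Qed.

End complex_exponential.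

(** * The Hilbert space *)

(** Up to a constant this is the centred normal density of variance 1 / (2 k). *)
Lemma integrable_expR_Nsq (R : realType) (k : R) : 0 < k ->
  (@lebesgue_measure R).-integrable setT (EFin \o (fun x => expR (- (k * x ^+ 2)))).
Proof.
move=> k0; pose s := Num.sqrt (2 * k)^-1.
have k2 : 0 < (2 * k)^-1 by rewrite invr_gt0 mulr_gt0.
have s0 : s != 0 by rewrite gt_eqF// sqrtr_gt0.
have p0 := normal_peak_gt0 s0.
have := integrableZl measurableT (normal_peak s)^-1 (integrable_normal_pdf 0 s).
congr (_.-integrable _ _); apply/funext => x /=.
rewrite normal_pdfE// /normal_fun subr0 -EFinM mulrA mulVf ?gt_eqF// mul1r.
congr (expR _)%:E; rewrite /s sqr_sqrtr ?ltW//.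
by rewrite mulr2n; field; rewrite gt_eqF.
Qed.

Lemma ible_expR_Nnsq (R : realType) (k : R) : 0 < k ->
  ible (fun p : R * R => expR (- (k * nsq p))).
Proof.
move=> k0; have I1 := integrable_expR_Nsq k0.
have cE : continuous (fun p : R * R => expR (- (k * nsq p))).
  have cn : continuous (@nsq R) := C1_continuous (@C1_nsq R).
  have c2 : continuous (fun p : R * R => - (k * nsq p)) by cts.
  by move=> p; exact: (continuous_comp (c2 p) (@continuous_expR R _)).
apply/integrable12ltyP.
  by apply/measurable_EFinP; exact: continuous_measurable_fun2 cE.
pose J := fine (\int[@lebesgue_measure R]_x (expR (- (k * x ^+ 2)))%:E).
have JE : (\int[@lebesgue_measure R]_x (expR (- (k * x ^+ 2)))%:E = J%:E)%E.
  by rewrite fineK//; exact: (integrable_fin_num measurableT I1).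
rewrite (_ : \int[_]_x _ = (J * J)%:E)%E ?ltry//.
transitivity (\int[@lebesgue_measure R]_x (J%:E * (expR (- (k * x ^+ 2)))%:E))%E.
  apply: eq_integral => x _.
  rewrite -JE muleC -integralZl//; apply: eq_integral => y _ /=.
  by rewrite ger0_norm ?expR_ge0// -EFinM -expRD /nsq/= -opprD -mulrDr.
by rewrite integralZl// JE.
Qed.

Section square_integrable.
Variable R : realType.
Implicit Types (f g : R[i] -> R[i]) (p : R * R).
Let rho := @gauss_weight R.

Definition re_at f p := complex.Re (at_point f p).
Definition im_at f p := complex.Im (at_point f p).

(** Continuity is part of the definition: it supplies measurability, and it makes a function of zero
    norm vanish at every point. *)
Definition L2 f := [/\ continuous (re_at f), continuous (im_at f) &
  ible (fun p => (re_at f p ^+ 2 + im_at f p ^+ 2) * rho p)].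

Lemma gauss_weight_ge0 p : 0 <= rho p.
Proof. by rewrite mulr_ge0 ?expR_ge0// invr_ge0 pi_ge0. Qed.

Lemma sqr_normc (z : R[i]) : normc z ^+ 2 = complex.Re z ^+ 2 + complex.Im z ^+ 2.
Proof. by case: z => a b /=; rewrite sqr_sqrtr// addr_ge0 ?sqr_ge0. Qed.

(** The quadratic part of the exponent of the squared Gaussian is at most 2 |al| |z|^2, below the
    decay of the weight. The factor [1 + nsq p] leaves room for an affine factor, such as the one in
    the derivative of a Gaussian. *)
Lemma gaussian_weight_le (al : R) (b : R[i]) : `|al| < 2^-1 ->
  exists2 k : R, 0 < k & exists K : R, forall p,
   (1 + nsq p) * normc (gaussian al%:C b (p.1 +i* p.2)) ^+ 2 * rho p
     <= K * expR (- (k * nsq p)).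
Proof.
move=> al2; pose d : R := 1 - 2 * `|al|.
have d0 : 0 < d by rewrite /d; lra.
(* Of the available decay [d], one quarter absorbs the linear term [b z] (by completing squares, at
   the cost of the constant [B]) and one quarter absorbs [1 + nsq p]; [d / 2] remains. *)
pose e := d / 4; have e0 : 0 < e by rewrite divr_gt0.
exists (d / 2); first by rewrite divr_gt0.
case: b => b1 b2; pose B := (b1 ^+ 2 + b2 ^+ 2) / e.
exists ((1 + e^-1) * expR B * pi^-1) => -[x y].
rewrite normc_cexp /gauss_weight /nsq /=.
set r := x ^+ 2 + y ^+ 2.
have r0 : 0 <= r by rewrite addr_ge0 ?sqr_ge0.
have H1 : 1 + r <= (1 + e^-1) * expR (e * r).
  have h := expR_ge1Dx (e * r).
  have e1 : 0 < 1 + e^-1 by rewrite addr_gt0 ?invr_gt0.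
  apply: le_trans (ler_wpM2l (ltW e1) h).
  have -> : (1 + e^-1) * (1 + e * r) = 1 + r + (e^-1 + e * r) by field; rewrite gt_eqF.
  by rewrite lerDl; have ? := ltW e0; rewrite addr_ge0 ?invr_ge0// mulr_ge0.
rewrite -expRM_natl.
set t := (X in _ * expR X * _).
have H2 : t <= (1 - d) * r + e * r + B.
  have ha := ler_norm al; have hb := ler_norm (- al); rewrite normrN in hb.
  have s1 := sqr_ge0 (e * x - b1); have s2 := sqr_ge0 (e * y + b2).
  have Be : e * B = b1 ^+ 2 + b2 ^+ 2 by rewrite /B mulrC divfK ?gt_eqF.
  have hx := sqr_ge0 x; have hy := sqr_ge0 y.
  have h1 : 0 <= (`|al| - al) * x ^+ 2 by rewrite mulr_ge0 ?subr_ge0.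
  have h2 : 0 <= (`|al| + al) * y ^+ 2 by rewrite mulr_ge0// -lerBlDr sub0r.
  have h3 : 2 * (b1 * x - b2 * y) <= e * r + B.
    have : e * (2 * (b1 * x - b2 * y)) <= e * (e * r) + e * B by rewrite Be /r; lra.
    by rewrite -mulrDr ler_pM2l.
  have dr : (1 - d) * r = 2 * `|al| * x ^+ 2 + 2 * `|al| * y ^+ 2.
    by rewrite /d /r; ring.
  have -> : t = 2 * al * x ^+ 2 + - (2 * al) * y ^+ 2 + 2 * (b1 * x - b2 * y).
    by rewrite /t; ring.
  lra.
have H3 : expR t <= expR ((1 - d) * r + e * r + B) by rewrite ler_expR.
have -> : (1 + e^-1) * expR B / pi * expR (- (d / 2 * r)) =
  ((1 + e^-1) * expR (e * r)) * expR ((1 - d) * r + e * r + B) * (pi^-1 * expR (- r)).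
  have -> : expR (- (d / 2 * r)) = expR (e * r) * expR ((1 - d) * r + e * r) * expR (- r).
    by rewrite -!expRD; congr (expR _); rewrite /e; field.
  by rewrite [expR (_ + B)]expRD; ring.
rewrite ler_wpM2r ?mulr_ge0 ?invr_ge0 ?pi_ge0 ?expR_ge0//.
by rewrite ler_pM// ?expR_ge0// addr_ge0.
Qed.

Lemma re_at_normc f p : re_at f p ^+ 2 + im_at f p ^+ 2 = normc (at_point f p) ^+ 2.
Proof. by rewrite sqr_normc. Qed.

Lemma continuous_nrm2 f : continuous (re_at f) -> continuous (im_at f) ->
  continuous (fun p => (re_at f p ^+ 2 + im_at f p ^+ 2) * rho p).
Proof.
move=> cr ci; have cw : continuous rho := C1_continuous (C1_gauss R).
cts.
Qed.

Lemma fnormE f : L2 f -> fnorm f = (Num.sqrt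
  (intg (fun p => (re_at f p ^+ 2 + im_at f p ^+ 2) * rho p)))%:E.
Proof.
move=> [cr ci I]; rewrite /fnorm /Rintegral.
have <- : EFin \o (fun p => (re_at f p ^+ 2 + im_at f p ^+ 2) * rho p) =
    (fun p => (normc (at_point f p) ^+ 2 * gauss_weight p)%:E).
  by apply/funext => p; rewrite /= re_at_normc.
by have /fineK <- := integrable_fin_num measurableT I.
Qed.

Lemma L2_fnorm f : continuous (re_at f) -> continuous (im_at f) ->
  (fnorm f < +oo)%E <-> L2 f.
Proof.
move=> cr ci; split=> [|/fnormE ->]; last exact: ltry.
move=> fy; split => //; apply/integrableP; split.
  by apply/measurable_EFinP; exact: continuous_measurable_fun2 (continuous_nrm2 cr ci).
move: fy; rewrite /fnorm.
have -> : (fun p => (normc (at_point f p) ^+ 2 * gauss_weight p)%:E) =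
    (fun p => abse ((re_at f p ^+ 2 + im_at f p ^+ 2) * rho p)%R%:E).
  apply/funext => p /=; rewrite re_at_normc ger0_norm// mulr_ge0 ?sqr_ge0//.
  exact: gauss_weight_ge0.
have H (x : \bar R) : (sqrte x < +oo -> x < +oo)%E.
  by case: x => [x|//|]; rewrite ?ltry.
exact: H.
Qed.

Lemma L2_affine_gaussian (al : R) (a b c C : R[i]) : `|al| < 2^-1 ->
  L2 (fun z => (a * z + c) * (C * gaussian al%:C b z)).
Proof.
move=> /(gaussian_weight_le b)[k k0 [K HK]].
set f := fun z => _.
have df z : exists l, cdiff f z l.
  eexists; apply: cdiffM; last by apply: cdiffM; [exact: cdiff_cst|exact: cdiff_gaussian].
  apply: cdiffD; last exact: cdiff_cst.
  by apply: cdiffM; [exact: cdiff_cst|exact: cdiff_id].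
have [cr ci] := cdiff_continuous df; split => //.
(* From |a z + c|^2 <= 2 |a|^2 |z|^2 + 2 |c|^2 <= [K1] (1 + |z|^2). *)
pose K1 := 2 * normc a ^+ 2 + 2 * normc c ^+ 2.
apply: (ible_le (continuous_nrm2 cr ci) (ibleZ (K1 * normc C ^+ 2 * K) (ible_expR_Nnsq k0))).
move=> p; rewrite re_at_normc ger0_norm; last first.
  by rewrite mulr_ge0 ?sqr_ge0 ?gauss_weight_ge0.
have K10 : 0 <= K1 by rewrite addr_ge0// mulr_ge0// sqr_ge0.
have C0 : 0 <= normc C ^+ 2 by rewrite sqr_ge0.
have -> : at_point f p = (a * (p.1 +i* p.2) + c) * (C * gaussian al%:C b (p.1 +i* p.2)) by [].
have g0 : 0 <= normc (gaussian al%:C b (p.1 +i* p.2)) ^+ 2 by rewrite sqr_ge0.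
have H := HK p.
rewrite (normcM (a * _ + c)) (normcM C) !exprMn -[leRHS]mulrA.
apply: le_trans (ler_wpM2l (mulr_ge0 K10 C0) H).
rewrite [leRHS](_ : _ = (K1 * (1 + nsq p)) * (normc C ^+ 2 *
  normc (gaussian al%:C b (p.1 +i* p.2)) ^+ 2) * rho p); last by ring.
apply: (ler_wpM2r (gauss_weight_ge0 p)); apply: (ler_wpM2r (mulr_ge0 C0 g0)).
have nz : normc (p.1 +i* p.2) ^+ 2 = nsq p by rewrite sqr_normc.
have T : normc (a * (p.1 +i* p.2) + c) <= normc a * normc (p.1 +i* p.2) + normc c.
  by rewrite -normcM le_normcD.
have T2 : normc (a * (p.1 +i* p.2) + c) ^+ 2 <= (normc a * normc (p.1 +i* p.2) + normc c) ^+ 2.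
  by rewrite ler_pXn2r ?nnegrE ?addr_ge0 ?mulr_ge0 ?normc_ge0.
apply: le_trans T2 _.
have s := sqr_ge0 (normc a * normc (p.1 +i* p.2) - normc c).
have n0 := nsq_ge0 p.
have m1 : 0 <= normc a ^+ 2 by rewrite sqr_ge0.
have m2 : 0 <= normc c ^+ 2 * nsq p by rewrite mulr_ge0// sqr_ge0.
rewrite /K1 -nz in m2 *; lra.
Qed.

End square_integrable.

(** * The real inner product on square integrable continuous functions *)

Section hilbert.
Variable R : realType.
Implicit Types (f g h : R[i] -> R[i]) (p : R * R) (w : R[i]).
Let rho := @gauss_weight R.

(* The real part of [inner f g]; its imaginary part is [rip f (muli g)]. *)
Definition rip f g :=
  intg (fun p => (re_at f p * re_at g p + im_at f p * im_at g p) * rho p).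

Definition muli f : R[i] -> R[i] := fun z => 'i * f z.

Lemma re_at_subZ g w f p : re_at (subZ g w f) p =
  re_at g p - (complex.Re w * re_at f p - complex.Im w * im_at f p).
Proof.
rewrite /re_at /im_at /at_point /subZ; case: (g _) (f _) w => ? ? [? ?] [? ?]. by [].
Qed.

Lemma im_at_subZ g w f p : im_at (subZ g w f) p =
  im_at g p - (complex.Re w * im_at f p + complex.Im w * re_at f p).
Proof.
by rewrite /im_at /re_at /at_point /subZ; case: (g _) (f _) w => ? ? [? ?] [? ?].
Qed.

Lemma re_at_muli f p : re_at (muli f) p = - im_at f p.
Proof.
by rewrite /re_at /im_at /at_point /muli; case: (f _) => ? ? /=; rewrite mul0r mul1r sub0r.
Qed.

Lemma im_at_muli f p : im_at (muli f) p = re_at f p.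
Proof.
by rewrite /re_at /im_at /at_point /muli; case: (f _) => ? ? /=; rewrite mul0r mul1r add0r.
Qed.

Lemma rip_ible f g : L2 f -> L2 g ->
  ible (fun p => (re_at f p * re_at g p + im_at f p * im_at g p) * rho p).
Proof.
move=> [cf1 cf2 If] [cg1 cg2 Ig].
have cr : continuous rho := C1_continuous (C1_gauss R).
apply: (ible_le _ (ibleD If Ig)); first by cts.
move=> p; rewrite -mulrDl normrM (ger0_norm (gauss_weight_ge0 p)) ler_wpM2r ?gauss_weight_ge0//.
move: (re_at f p) (im_at f p) (re_at g p) (im_at g p) => a b c d.
have := sqr_ge0 (a - c); have := sqr_ge0 (b - d).
have := sqr_ge0 (a + c); have := sqr_ge0 (b + d).
have := sqr_ge0 a; have := sqr_ge0 b; have := sqr_ge0 c; have := sqr_ge0 d.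
by move=> *; rewrite ler_norml; apply/andP; split; lra.
Qed.

Lemma L2_subZ g w f : L2 g -> L2 f -> L2 (subZ g w f).
Proof.
move=> Lg Lf; have [cf1 cf2 If] := Lf; have [cg1 cg2 Ig] := Lg.
have cr : continuous rho := C1_continuous (C1_gauss R).
have c1 : continuous (re_at (subZ g w f)).
  by rewrite (funext (re_at_subZ g w f)); cts.
have c2 : continuous (im_at (subZ g w f)).
  by rewrite (funext (im_at_subZ g w f)); cts.
split => //.
apply: (ible_le (continuous_nrm2 c1 c2) (ibleD (ibleZ 2 Ig) (ibleZ (2 * normc w ^+ 2) If))).
move=> p; rewrite ger0_norm; last by rewrite mulr_ge0 ?gauss_weight_ge0// addr_ge0 ?sqr_ge0.
rewrite (mulrA 2) (mulrA (2 * normc w ^+ 2)) -mulrDl ler_wpM2r ?gauss_weight_ge0//.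
rewrite re_at_subZ im_at_subZ sqr_normc.
move: (re_at f p) (im_at f p) (re_at g p) (im_at g p) (complex.Re w) (complex.Im w) => a b c d x y.
have := sqr_ge0 (c + (x * a - y * b)); have := sqr_ge0 (d + (x * b + y * a)).
by move=> *; lra.
Qed.

Lemma L2_muli f : L2 f -> L2 (muli f).
Proof.
move=> [c1 c2 I]; split.
- by rewrite (funext (re_at_muli f)); cts.
- by rewrite (funext (im_at_muli f)).
- rewrite (_ : (fun p => _) = (fun p => (re_at f p ^+ 2 + im_at f p ^+ 2) * rho p))//.
  by apply/funext => p; rewrite re_at_muli im_at_muli sqrrN addrC.
Qed.

Lemma ripC f g : rip f g = rip g f.
Proof. by congr (intg _); apply/funext => p; ring. Qed.

Lemma rip_muli2 f g : rip (muli f) (muli g) = rip f g.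
Proof.
by congr (intg _); apply/funext => p; rewrite !re_at_muli !im_at_muli; ring.
Qed.

Lemma rip_subZl g w f h : L2 g -> L2 f -> L2 h -> rip (subZ g w f) h =
  rip g h - complex.Re w * rip f h - complex.Im w * rip (muli f) h.
Proof.
move=> Lg Lf Lh; have I1 := rip_ible Lg Lh; have I2 := rip_ible Lf Lh.
have I3 := rip_ible (L2_muli Lf) Lh.
rewrite /rip -(intgZ _ I2) -(intgZ _ I3) -(intgB I1 (ibleZ _ I2)).
rewrite -(intgB (ibleB I1 (ibleZ _ I2)) (ibleZ _ I3)).
congr (intg _); apply/funext => p.
by rewrite re_at_subZ im_at_subZ re_at_muli im_at_muli; ring.
Qed.

Lemma rip_subZr g w f h : L2 g -> L2 f -> L2 h -> rip h (subZ g w f) =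
  rip h g - complex.Re w * rip h f - complex.Im w * rip h (muli f).
Proof. by move=> *; rewrite ripC rip_subZl// !(ripC h). Qed.

Lemma rip_mulil f g : L2 f -> L2 g -> rip (muli f) g = - rip f (muli g).
Proof.
move=> Lf Lg; rewrite -[RHS]mulN1r -intgZ; last exact: rip_ible (L2_muli _).
congr (intg _); apply/funext => p.
by rewrite !re_at_muli !im_at_muli; ring.
Qed.

Lemma rip_muli_self f : L2 f -> rip f (muli f) = 0.
Proof.
move=> Lf; have := rip_mulil Lf Lf; rewrite ripC => H.
by move: (rip _ _) H => a; lra.
Qed.

Lemma rip_ge0 f : 0 <= rip f f.
Proof.
apply: Rintegral_ge0 => p _.
by rewrite mulr_ge0 ?gauss_weight_ge0// addr_ge0// -expr2 sqr_ge0.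
Qed.

Lemma fnorm_rip f : L2 f -> fnorm f = (Num.sqrt (rip f f))%:E.
Proof. by move=> Lf; rewrite fnormE. Qed.

Lemma inner_rip f g : inner f g = rip f g +i* rip f (muli g).
Proof.
rewrite /inner; congr (_ +i* _); congr (intg _); apply/funext => p.
  rewrite /re_at /im_at; case: (at_point f p) (at_point g p) => ? ? [? ?] /=.
  by congr (_ * _); ring.
rewrite re_at_muli im_at_muli /re_at /im_at.
case: (at_point f p) (at_point g p) => ? ? [? ?] /=.
by congr (_ * _); ring.
Qed.

(** If F were positive at p, it would exceed F p / 2 on a square of side e about p, and its integral
    would be at least e^2 F p / 2. *)
Lemma continuous_intg_eq0 (F : R * R -> R) : continuous F -> ible F ->
  (forall p, 0 <= F p) -> intg F = 0 -> forall p, F p = 0.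
Proof.
move=> cF iF F0 I0 p; apply/eqP; rewrite eq_le F0 andbT leNgt; apply/negP => Fp.
have [e e0 He] : exists2 e : R, 0 < e & forall q, ball p e q -> F p / 2 < F q.
  have : \forall q \near p, F p / 2 < F q.
    have lt2 : F p / 2 < F p by lra.
    exact: (cvgr_gt _ (cF p) _ lt2).
  by move=> /nbhs_ballP[e /= e0 He]; exists e.
pose A1 : set R := `[p.1 - e / 2, p.1 + e / 2]%classic.
pose A2 : set R := `[p.2 - e / 2, p.2 + e / 2]%classic.
have AF q : (A1 `*` A2) q -> F p / 2 <= F q.
  move=> [/=]; rewrite /A1 /A2 /= !in_itv/= => /andP[? ?] /andP[? ?].
  apply/ltW/He; split; rewrite /ball/= ltr_distl; apply/andP; split; lra.
have mA : measurable (A1 `*` A2 : set (measurableTypeR R * measurableTypeR R)).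
  by apply: measurableX; exact: measurable_itv.
have muA : area R (A1 `*` A2) = (e * e)%:E.
  have -> : area R (A1 `*` A2) = (@lebesgue_measure R A1 * @lebesgue_measure R A2)%E.
    by apply: product_measure1E; exact: measurable_itv.
  rewrite /A1 /A2 !lebesgue_measure_itv /= !lte_fin.
  have E (x : R) : (x - e / 2 < x + e / 2) by lra.
  by rewrite !E -!EFinB -EFinM; congr (_%:E); field.
have mF : measurable_fun (setT : set (measurableTypeR R * measurableTypeR R)) (EFin \o F).
  by apply/measurable_EFinP; exact: continuous_measurable_fun2.
have IF : (\int[area R]_q (F q)%:E = 0)%E.
  have := integrable_fin_num measurableT iF => /fineK <-.
  by congr (_%:E).
have : ((F p / 2)%:E * area R (A1 `*` A2)%classic <= 0)%E.
  rewrite -IF -integral_cst//.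
  apply: (@le_trans _ _ (\int[area R]_(q in A1 `*` A2) (F q)%:E)%E).
    apply: ge0_le_integral => //.
    - by move=> q _; rewrite lee_fin divr_ge0// ltW.
    - exact: measurable_funS mF.
  by apply: ge0_subset_integral => // q _; rewrite lee_fin.
rewrite muA -EFinM lee_fin leNgt => /negP; apply.
by rewrite !mulr_gt0// divr_gt0.
Qed.

Lemma rip_eq0 f : L2 f -> rip f f = 0 -> forall z, f z = 0.
Proof.
move=> Lf f0 [x y]; have I := rip_ible Lf Lf; have [c1 c2 _] := Lf.
have cr : continuous rho := C1_continuous (C1_gauss R).
have : (re_at f (x, y) * re_at f (x, y) + im_at f (x, y) * im_at f (x, y)) * rho (x, y) = 0.
  apply: (continuous_intg_eq0 _ I _ f0 (x, y)); first by cts.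
  by move=> p; rewrite mulr_ge0 ?gauss_weight_ge0// addr_ge0// -expr2 sqr_ge0.
rewrite /re_at /im_at /at_point/=; case: (f _) => a b /= /eqP.
have r0 : rho (x, y) != 0.
  by rewrite gt_eqF// /rho /gauss_weight mulr_gt0 ?expR_gt0// invr_gt0 pi_gt0.
rewrite mulf_eq0 (negbTE r0) orbF paddr_eq0 -?expr2 ?sqr_ge0//.
by rewrite !sqrf_eq0 => /andP[/eqP-> /eqP->].
Qed.

End hilbert.

(** * Adjointness and commutation of differentiation and multiplication by z *)

Section fock_identities.
Variable R : realType.
Implicit Types (f g : R[i] -> R[i]) (p : R * R).

Lemma entire_cdiff f : entire f <-> forall z, cdiff f z (cderiv f z).
Proof.
split=> [Ef z|H z]; first by apply/cdiffP.
by have /cdiffP[] := H z.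
Qed.

Lemma entire_continuous f : entire f ->
  continuous (re_at f) /\ continuous (im_at f).
Proof.
by move=> /entire_cdiff Ef; apply: cdiff_continuous => z; exists (cderiv f z).
Qed.

Lemma fockP f : fock f <-> entire f /\ L2 f.
Proof.
split=> [[Ef nf]|[Ef Lf]]; split => //.
  by have [c1 c2] := entire_continuous Ef; apply/(L2_fnorm c1 c2).
by have [c1 c2 _] := Lf; apply/(L2_fnorm c1 c2).
Qed.

Lemma entire_C1 f : entire f -> entire (cderiv f) ->
  C1 (re_at f) (re_at (cderiv f)) (fun p => - im_at (cderiv f) p) /\
  C1 (im_at f) (im_at (cderiv f)) (re_at (cderiv f)).
Proof.
move=> Ef ED; have [c1 c2] := entire_continuous Ef.
have [d1 d2] := entire_continuous ED.
have d2N : continuous (fun p => - im_at (cderiv f) p) by cts.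
have P x y := cdiff_partials ((entire_cdiff f).1 Ef (x +i* y)).
by split; split => //; move=> x y; have [] := P x y.
Qed.

Lemma re_at_mulz f p : re_at (mulz f) p = p.1 * re_at f p - p.2 * im_at f p.
Proof. by rewrite /re_at /im_at /at_point /mulz; case: (f _). Qed.

Lemma im_at_mulz f p : im_at (mulz f) p = p.1 * im_at f p + p.2 * re_at f p.
Proof. by rewrite /re_at /im_at /at_point /mulz; case: (f _). Qed.

Section identities.
Variable f : R[i] -> R[i].
Hypotheses (Ef : entire f) (ED : entire (cderiv f)) (Lf : L2 f) (LD : L2 (cderiv f)).

Let D := cderiv f.
Let M := mulz f.
Let Cu := (entire_C1 Ef ED).1.
Let Cv := (entire_C1 Ef ED).2.
Let If : ible (fun p => (re_at f p ^+ 2 + im_at f p ^+ 2) * gauss_weight p).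
Proof. by case: Lf. Qed.
Let ID : ible (fun p => (re_at D p ^+ 2 + im_at D p ^+ 2) * gauss_weight p).
Proof. by case: LD. Qed.

Let normM p : (re_at M p ^+ 2 + im_at M p ^+ 2) * gauss_weight p =
  nsq p * (re_at f p ^+ 2 + im_at f p ^+ 2) * gauss_weight p.
Proof. by rewrite re_at_mulz im_at_mulz /nsq; ring. Qed.

Lemma L2_mulz : L2 M.
Proof.
have [c1 c2 _] := Lf; have cf := continuous_fst2; have cs := continuous_snd2.
split.
- by rewrite (funext (re_at_mulz f)); cts.
- by rewrite (funext (im_at_mulz f)); cts.
- by rewrite (funext normM); exact: (ible_nsq Cu Cv If ID).
Qed.

Lemma rip_sqr g : rip g g = intg (fun p => (re_at g p ^+ 2 + im_at g p ^+ 2) * gauss_weight p).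
Proof. by congr (intg _); apply/funext => p; congr (_ * _); ring. Qed.

Lemma rip_mulz_mulz : rip M M = rip D D + rip f f.
Proof.
by rewrite !rip_sqr (funext normM) (intg_nsq Cu Cv If ID) addrC.
Qed.

Lemma rip_deriv : rip D f = rip M f.
Proof.
have := intg_fst Cu Cv If ID; rewrite /rip => E.
transitivity (intg (fun z => (re_at f z * re_at D z + im_at f z * im_at D z) * gauss_weight z)).
  by congr (intg _); apply/funext => p; ring.
rewrite E; congr (intg _); apply/funext => p; rewrite re_at_mulz im_at_mulz; ring.
Qed.

Lemma rip_deriv_muli : rip D (muli f) = - rip M (muli f).
Proof.
have := intg_snd Cu Cv If ID; rewrite /rip => E.
rewrite -mulN1r -intgZ; last exact: rip_ible L2_mulz (L2_muli Lf).
transitivity (- 1 * intg (fun z => (im_at f z * re_at D z - re_at f z * im_at D z) * gauss_weight z)).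
  rewrite -intgZ.
    by congr (intg _); apply/funext => p; rewrite re_at_muli im_at_muli; ring.
  have := rip_ible LD (L2_muli Lf); move/(ibleZ (- 1)).
  congr (_.-integrable _ (EFin \o _)); apply/funext => p.
  by rewrite re_at_muli im_at_muli; ring.
rewrite E -intgZ; last first.
  have := rip_ible L2_mulz (L2_muli Lf).
  congr (_.-integrable _ (EFin \o _)); apply/funext => p.
  by rewrite re_at_muli im_at_muli re_at_mulz im_at_mulz; ring.
by congr (intg _); apply/funext => p; rewrite re_at_muli im_at_muli re_at_mulz im_at_mulz; ring.
Qed.

Lemma fplusE : fplus f = subZ D (- 1) M.
Proof. by apply/funext => z; rewrite /fplus /subZ mulN1r opprK. Qed.

Lemma fminusE : fminus f = subZ D 1 M.
Proof. by apply/funext => z; rewrite /fminus /subZ mul1r. Qed.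

Lemma L2_fplus : L2 (fplus f).
Proof. by rewrite fplusE; apply: L2_subZ => //; exact: L2_mulz. Qed.

Lemma L2_fminus : L2 (fminus f).
Proof. by rewrite fminusE; apply: L2_subZ => //; exact: L2_mulz. Qed.

Let LM := L2_mulz.

Let rip_plus g : L2 g -> rip (fplus f) g = rip D g + rip M g.
Proof.
by move=> Lg; rewrite fplusE rip_subZl//= oppr0 mul0r subr0 mulN1r opprK.
Qed.

Let rip_minus g : L2 g -> rip (fminus f) g = rip D g - rip M g.
Proof. by move=> Lg; rewrite fminusE rip_subZl//= mul0r subr0 mul1r. Qed.

(** Symmetry of f |-> f' + z f on the diagonal: its inner product with f is real. *)
Lemma rip_fplus_muli : rip (fplus f) (muli f) = 0.
Proof. by rewrite rip_plus ?rip_deriv_muli ?addNr//; exact: L2_muli. Qed.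

Lemma rip_fminus : rip (fminus f) f = 0.
Proof. by rewrite rip_minus// rip_deriv subrr. Qed.

Lemma inner_fplus : inner (fplus f) f = (rip (fplus f) f)%:C.
Proof. by rewrite inner_rip rip_fplus_muli. Qed.

Lemma inner_fminus : inner (fminus f) f = 0 +i* rip (fminus f) (muli f).
Proof. by rewrite inner_rip rip_fminus. Qed.

Lemma rip_fplus_fminus : rip (fplus f) (fminus f) = - rip f f.
Proof.
rewrite rip_plus ?(ripC _ (fminus f)) ?rip_minus//; last exact: L2_fminus.
rewrite (ripC M D) rip_mulz_mulz; ring.
Qed.

(** The shifts do not affect the real part: the three extra terms carry the imaginary part of <f' +
    z f, f>, the real part of <f' - z f, f> and the real part of <f, i f>, all of which are 0. *)
Lemma rip_shifted (a b : R) :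
  rip (subZ (fplus f) a%:C f) (subZ (fminus f) (0 +i* b) f) = - rip f f.
Proof.
have LA := L2_fplus; have LB := L2_fminus; have Li := L2_muli Lf.
have LV : L2 (subZ (fminus f) (0 +i* b) f) by exact: L2_subZ.
rewrite rip_subZl//= !rip_subZr//= rip_fplus_fminus rip_fplus_muli.
rewrite (ripC f (fminus f)) rip_fminus rip_muli_self//.
by rewrite !(mul0r, mulr0, subr0).
Qed.

(** Rewrites the sum of squares in (c) as half of ||f' + z f||^2 + ||f' - z f||^2, to be compared
    with the product in (b). *)
Lemma parallelogram : rip (fplus f) (fplus f) + rip (fminus f) (fminus f) =
  2 * (rip D D + rip M M).
Proof.
rewrite rip_plus ?rip_minus; [|exact: L2_fminus|exact: L2_fplus].
rewrite !(ripC D (fplus _)) !(ripC M (fplus _)) !(ripC D (fminus _)) !(ripC M (fminus _)).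
rewrite !rip_plus ?rip_minus//; rewrite (ripC M D); ring.
Qed.

End identities.
End fock_identities.

(** * Cauchy-Schwarz with its equality case, projection onto a line, angles *)

Section cauchy_schwarz.
Variable R : realType.
Implicit Types (f g U V : R[i] -> R[i]).

Lemma rip_subZ2 g (w : R[i]) f : L2 g -> L2 f -> rip (subZ g w f) (subZ g w f) =
  rip g g - 2 * (complex.Re w * rip g f + complex.Im w * rip g (muli f))
  + (complex.Re w ^+ 2 + complex.Im w ^+ 2) * rip f f.
Proof.
move=> Lg Lf; have Li := L2_muli Lf; have LS := L2_subZ w Lg Lf.
rewrite rip_subZl// !rip_subZr// (ripC (muli f) f) rip_muli_self// rip_muli2.
rewrite (ripC f g) (ripC (muli f) g); ring.
Qed.

Lemma rip_scale U V (c : R) g : L2 V -> L2 g ->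
  (forall z, U z = - c%:C * V z) -> rip U g = - c * rip V g.
Proof.
move=> LV Lg UV; rewrite -intgZ; last exact: rip_ible.
congr (intg _); apply/funext => p.
have -> : re_at U p = - c * re_at V p.
  by rewrite /re_at /at_point UV; case: (V _) => a b /=; ring.
have -> : im_at U p = - c * im_at V p.
  by rewrite /im_at /at_point UV; case: (V _) => a b /=; ring.
ring.
Qed.

(** Nonnegativity of ||U + t V||^2 for real t, taken at its minimum t = N / ||V||^2. *)
Lemma rip_cauchy_schwarz U V (N : R) : L2 U -> L2 V -> 0 <= N -> rip U V = - N ->
  N <= Num.sqrt (rip U U) * Num.sqrt (rip V V).
Proof.
move=> LU LV N0 UV.
have H (t : R) : 0 <= rip U U - 2 * t * N + t ^+ 2 * rip V V.
  have := rip_ge0 (subZ U (- t)%:C V); rewrite rip_subZ2//= UV.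
  congr (0 <= _); ring.
rewrite -sqrtrM ?rip_ge0// -(ger0_norm N0) -sqrtr_sqr ler_wsqrtr//.
have u0 := rip_ge0 U; have v0 := rip_ge0 V.
have [vz|v1] := eqVneq (rip V V) 0.
  rewrite vz mulr0; have [->|Nn] := eqVneq N 0; first by rewrite expr0n.
  (* Here the quadratic degenerates to an affine function of slope - 2 N; this t makes it negative,
     so that N must be 0. *)
  have := H ((rip U U + 1) / N); rewrite vz mulr0 addr0 -mulrA divfK//.
  lra.
have := H (N / rip V V).
have -> : rip U U - 2 * (N / rip V V) * N + (N / rip V V) ^+ 2 * rip V V =
  (rip U U * rip V V - N ^+ 2) / rip V V by field.
by rewrite pmulr_lge0 ?subr_ge0// invr_gt0 lt_def v1.
Qed.

(** Both norms are nonzero because their product is N > 0. With c = ||U|| / ||V||, the square ||U +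
    c V||^2 vanishes, and continuity turns this into a pointwise identity. *)
Lemma rip_cauchy_schwarz_eq U V (N : R) : L2 U -> L2 V -> 0 < N -> rip U V = - N ->
  Num.sqrt (rip U U) * Num.sqrt (rip V V) = N <->
  exists2 c : R, 0 < c & forall z, U z = - c%:C * V z.
Proof.
move=> LU LV N0 UV; split => [E|[c c0 H]].
  have u0 := rip_ge0 U; have v0 := rip_ge0 V.
  have su := sqrtr_ge0 (rip U U); have sv := sqrtr_ge0 (rip V V).
  have su1 : 0 < Num.sqrt (rip U U).
    by rewrite lt_def su andbT; apply/eqP => s0; move: N0; rewrite -E s0 mul0r ltxx.
  have sv1 : 0 < Num.sqrt (rip V V).
    by rewrite lt_def sv andbT; apply/eqP => s0; move: N0; rewrite -E s0 mulr0 ltxx.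
  pose c := Num.sqrt (rip U U) / Num.sqrt (rip V V).
  exists c; first by rewrite divr_gt0.
  have H0 : rip (subZ U (- c)%:C V) (subZ U (- c)%:C V) = 0.
    have cE : c * Num.sqrt (rip V V) = Num.sqrt (rip U U) by rewrite divfK ?gt_eqF.
    rewrite rip_subZ2//= UV -(sqr_sqrtr u0) -(sqr_sqrtr v0) -E -cE; ring.
  move=> z; have /eqP := rip_eq0 (L2_subZ _ LU LV) H0 z.
  by rewrite /subZ subr_eq0 => /eqP ->; rewrite rmorphN.
have E1 := rip_scale LV LV H; have E2 := rip_scale LV LU H.
have N1 : N = c * rip V V by apply: oppr_inj; rewrite -UV E1 mulNr.
have -> : rip U U = c ^+ 2 * rip V V by rewrite E2 ripC E1; ring.
rewrite sqrtrM ?sqr_ge0// sqrtr_sqr (gtr0_norm c0) -mulrA -expr2 sqr_sqrtr ?rip_ge0//.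
Qed.

(** Completing the square: ||g - w f||^2 = ||g - <g, f> f||^2 + |w - <g, f>|^2 for a unit vector
    f. *)
Lemma dist_line_proj g f : L2 g -> L2 f -> rip f f = 1 ->
  dist_line g f = fnorm (subZ g (inner g f) f).
Proof.
move=> Lg Lf f1; apply/eqP; rewrite eq_le; apply/andP; split.
  by apply: ereal_inf_lbound; exists (inner g f).
apply: le_ereal_inf_tmp => _ [w _ <-].
rewrite !fnorm_rip; [|exact: L2_subZ|exact: L2_subZ].
rewrite lee_fin ler_wsqrtr// !rip_subZ2// f1 inner_rip /=.
have := sqr_ge0 (complex.Re w - rip g f).
have := sqr_ge0 (complex.Im w - rip g (muli f)).
by move=> *; lra.
Qed.

(** Pythagoras: ||g||^2 - |<g, f>|^2 is the squared norm of the component of g orthogonal to f. This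
    identifies (b) with (a). *)
Lemma fnorm_sin_angle g f : L2 g -> L2 f -> rip f f = 1 ->
  0 <= sin (angle f g) /\
  Num.sqrt (rip g g) * sin (angle f g) =
    Num.sqrt (rip (subZ g (inner g f) f) (subZ g (inner g f) f)).
Proof.
move=> Lg Lf f1.
have E : rip (subZ g (inner g f) f) (subZ g (inner g f) f) =
    rip g g - normc (inner g f) ^+ 2.
  by rewrite rip_subZ2// f1 sqr_normc inner_rip /=; ring.
have P := rip_ge0 (subZ g (inner g f) f); rewrite E subr_ge0 in P.
rewrite /angle !fnorm_rip//= f1 sqrtr1 mulr1 E.
set n := normc _ in P *; have n0 : 0 <= n by exact: normc_ge0.
have g0 := rip_ge0 g; have s0 := sqrtr_ge0 (rip g g).
have x0 : 0 <= n / Num.sqrt (rip g g) by rewrite divr_ge0.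
have x1 : n / Num.sqrt (rip g g) <= 1.
  have [->|sn] := eqVneq (Num.sqrt (rip g g)) 0; first by rewrite invr0 mulr0.
  rewrite ler_pdivrMr ?mul1r ?lt_def ?sn//.
  by rewrite -(ger0_norm n0) -sqrtr_sqr ler_wsqrtr.
rewrite sin_acos; last by rewrite x1 andbT (le_trans _ x0)// oppr_le0.
split; first exact: sqrtr_ge0.
rewrite -sqrtrM//; congr Num.sqrt.
(* For g of norm zero the quotient inside [acos] is 0 by the convention on division, and both sides
   vanish because [P] forces n = 0. *)
have [g1|gn] := eqVneq (rip g g) 0.
  by rewrite g1 in P *; rewrite mul0r; apply/eqP; rewrite eq_sym sub0r oppr_eq0 eq_le P sqr_ge0.
by rewrite expr_div_n (sqr_sqrtr g0) mulrBr mulr1 mulrC divfK.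
Qed.

End cauchy_schwarz.

(** * The uncertainty inequalities *)

Section extremal_functions.
Variable R : realType.
Implicit Types (f : R[i] -> R[i]) (w C : R[i]) (c : R).

Definition quad_coef c : R := (c - 1) / (2 * (c + 1)).

Lemma norm_quad_coef_lt c : 0 < c -> `|quad_coef c| < 2^-1.
Proof.
move=> c0; have c1 : 0 < c + 1 by rewrite addr_gt0.
rewrite /quad_coef ltr_norml; apply/andP; split.
  by rewrite ltr_pdivlMr ?mulr_gt0//; lra.
by rewrite ltr_pdivrMr ?mulr_gt0//; lra.
Qed.

(** Collecting the derivative gives (c + 1) f' = ((c - 1) z + w1 + c w2) f, and c + 1 is nonzero.
    The shifts are arbitrary complex numbers so that the inner products in the equality case of (c)
    are covered too. *)
Lemma shifted_ode f c w1 w2 : 0 < c ->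
  (forall z, fplus f z - w1 * f z = - c%:C * (fminus f z - w2 * f z)) <->
  (forall z, cderiv f z =
     (2 * (quad_coef c)%:C * z + (w1 + c%:C * w2) / (c + 1)%:C) * f z).
Proof.
move=> c0; have c1 : (c + 1)%:C != 0 :> R[i].
  by rewrite (inj_eq (@complexI R)) gt_eqF// addr_gt0.
have -> : (quad_coef c)%:C = (c%:C - 1) / (2 * (c + 1)%:C).
  by rewrite /quad_coef fmorph_div rmorphB rmorphM rmorph_nat rmorph1.
have cD : (c + 1)%:C = c%:C + 1 :> R[i] by rewrite rmorphD rmorph1.
rewrite cD in c1 *.
split=> H z; have := H z; rewrite /fplus /fminus /mulz.
  move: (cderiv f z) (f z) (c%:C) c1 => d v k k1 E.
  apply: (mulfI k1).
  have -> : (k + 1) * ((2 * ((k - 1) / (2 * (k + 1))) * z + (w1 + k * w2) / (k + 1)) * v) =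
    (k - 1) * z * v + (w1 + k * w2) * v by field.
  have {}E : d = - k * (d - z * v - w2 * v) - z * v + w1 * v by rewrite -E; ring.
  rewrite mulrDl mul1r {2}E; ring.
move=> ->; move: (f z) (c%:C) c1 => v k k1; field.
exact: k1.
Qed.

(** The derivative is an affine function times a Gaussian whose quadratic coefficient is below 1/2
    in modulus, so it is still square integrable for the weight. *)
Lemma gaussian_fock_deriv f (al : R) (b C : R[i]) : `|al| < 2^-1 ->
  f =1 (fun z => C * gaussian al%:C b z) ->
  (forall z, cderiv f z = (2 * al%:C * z + b) * f z) /\ fock (cderiv f).
Proof.
move=> al2 /funext fE.
have df z : cdiff f z ((2 * al%:C * z + b) * f z).
  rewrite fE; apply: (cdiff_eq (cdiffM (cdiff_cst C z) (cdiff_gaussian al%:C b z))).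
  by ring.
have DE z : cderiv f z = (2 * al%:C * z + b) * f z by have /cdiffP[] := df z.
split => //.
rewrite (funext DE); apply/fockP; split.
  move=> z; have [] // := iffLR (cdiffP (fun z => (2 * al%:C * z + b) * f z) z _)
    (cdiffM (cdiffD (cdiffM (cdiff_cst (2 * al%:C) z) (cdiff_id z)) (cdiff_cst b z)) (df z)).
by rewrite fE; exact: L2_affine_gaussian.
Qed.

Lemma extremalE a b c C z : extremal a b c C z =
  C * gaussian (quad_coef c)%:C ((a%:C + c%:C * (0 +i* b)) / (c + 1)%:C) z.
Proof.
have -> // : a%:C + c%:C * (0 +i* b) = a +i* (b * c).
by apply/eqP; rewrite eq_complex /=; apply/andP; split; apply/eqP; ring.
Qed.

Lemma extremal_shifted f (a b c : R) : 0 < c -> entire f ->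
  (exists C, f =1 extremal a b c C) <->
  (forall z, subZ (fplus f) a%:C f z = - c%:C * subZ (fminus f) (0 +i* b) f z).
Proof.
move=> c0 Ef; rewrite /subZ (shifted_ode f a%:C (0 +i* b) c0); split.
  move=> [C fE]; have [] // := @gaussian_fock_deriv f (quad_coef c)
    ((a%:C + c%:C * (0 +i* b)) / (c + 1)%:C) C (norm_quad_coef_lt c0).
  by move=> z; rewrite fE extremalE.
move=> H; have [z|C fC] := @gaussian_ode _ f (quad_coef c)%:C
    ((a%:C + c%:C * (0 +i* b)) / (c + 1)%:C).
  by apply: (cdiff_eq ((entire_cdiff f).1 Ef z)); rewrite H.
by exists C => z; rewrite fC extremalE.
Qed.

(** Excludes proportionality when the left-hand sides take the value +oo: a function satisfying it
    is a Gaussian, whose derivative is in the Fock space. *)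
Lemma shifted_fock_deriv f (c : R) w1 w2 : 0 < c -> entire f ->
  (forall z, fplus f z - w1 * f z = - c%:C * (fminus f z - w2 * f z)) ->
  fock (cderiv f).
Proof.
move=> c0 Ef /(shifted_ode f w1 w2 c0) H.
have [z|C fC] := @gaussian_ode _ f (quad_coef c)%:C ((w1 + c%:C * w2) / (c + 1)%:C).
  by apply: (cdiff_eq ((entire_cdiff f).1 Ef z)); rewrite H.
by have [] := gaussian_fock_deriv (norm_quad_coef_lt c0) fC.
Qed.

Lemma extremal_fock_deriv f (a b c : R) C : 0 < c -> entire f ->
  f =1 extremal a b c C -> fock (cderiv f).
Proof.
move=> c0 Ef fE; apply: (@shifted_fock_deriv f c a%:C (0 +i* b)) => //.
by apply/(extremal_shifted a b c0 Ef); exists C.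
Qed.

End extremal_functions.

(** * The inequalities for a fixed function of the Fock space *)

Section uncertainty.
Variable R : realType.
Variable f : R[i] -> R[i].
Hypotheses (Ff : fock f).
Let Ef : entire f := ((fockP f).1 Ff).1.
Let Lf : L2 f := ((fockP f).1 Ff).2.

Lemma sqr_fnorm : (fnorm f ^+ 2 = (rip f f)%:E)%E.
Proof. by rewrite fnorm_rip// -EFin_expe sqr_sqrtr ?rip_ge0. Qed.

Lemma lhs_fock x : fock (cderiv f) -> lhs f x = x.
Proof. by move=> H; rewrite /lhs asboolT. Qed.

Lemma lhs_Nfock x : ~ fock (cderiv f) -> lhs f x = +oo%E.
Proof. by move=> H; rewrite /lhs asboolF. Qed.

Section with_derivative.
Hypothesis FD : fock (cderiv f).
Let ED : entire (cderiv f) := ((fockP _).1 FD).1.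
Let LD : L2 (cderiv f) := ((fockP _).1 FD).2.
Let LA : L2 (fplus f) := L2_fplus Ef ED Lf LD.
Let LB : L2 (fminus f) := L2_fminus Ef ED Lf LD.
Let A := fplus f.
Let B := fminus f.

Let U (a : R) := subZ A a%:C f.
Let V (b : R) := subZ B (0 +i* b) f.

Lemma lhs_normsE a b : lhs_norms f a b =
  (Num.sqrt (rip (U a) (U a)) * Num.sqrt (rip (V b) (V b)))%:E.
Proof.
by rewrite /lhs_norms lhs_fock// !fnorm_rip//; exact: L2_subZ.
Qed.

Lemma lhs_norms_ge a b : rip f f <=
  Num.sqrt (rip (U a) (U a)) * Num.sqrt (rip (V b) (V b)).
Proof.
by apply: rip_cauchy_schwarz; [exact: L2_subZ|exact: L2_subZ|exact: rip_ge0|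
  exact: rip_shifted].
Qed.

Lemma lhs_norms_eq a b : 0 < rip f f ->
  Num.sqrt (rip (U a) (U a)) * Num.sqrt (rip (V b) (V b)) = rip f f <->
  exists (c : R) (C : R[i]), 0 < c /\ f =1 extremal a b c C.
Proof.
move=> f0; have LU : L2 (U a) by exact: L2_subZ.
have LV : L2 (V b) by exact: L2_subZ.
have UV : rip (U a) (V b) = - rip f f by exact: rip_shifted.
rewrite (rip_cauchy_schwarz_eq LU LV f0 UV); split.
  by move=> [c c0 /(extremal_shifted a b c0 Ef)[C fC]]; exists c, C.
by move=> [c [C [c0 fC]]]; exists c => //; apply/(extremal_shifted a b c0 Ef); exists C.
Qed.

Section unit_vector.
Hypothesis f1 : rip f f = 1.
(** The optimal shifts: <f' + z f, f> = [p0] is real and <f' - z f, f> = i [q0] is imaginary, so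
    projecting onto the line of f stays within the family of shifts a and i b. Hence [dA] and [dB]
    are the two distances. *)
Let p0 := rip A f.
Let q0 := rip B (muli f).
Let dA := Num.sqrt (rip (U p0) (U p0)).
Let dB := Num.sqrt (rip (V q0) (V q0)).

Let inA : inner A f = p0%:C. Proof. exact: inner_fplus. Qed.
Let inB : inner B f = 0 +i* q0. Proof. exact: inner_fminus. Qed.

Let f0 : 0 < rip f f. Proof. by rewrite f1. Qed.

Lemma lhs_distE : lhs_dist f = (dA * dB)%:E.
Proof.
rewrite /lhs_dist lhs_fock// !dist_line_proj// -/A -/B inA inB.
by rewrite !fnorm_rip//; exact: L2_subZ.
Qed.

Let sA := sin (angle f A).
Let sB := sin (angle f B).

Let sA0 : 0 <= sA. Proof. by have [] := fnorm_sin_angle LA Lf f1. Qed.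
Let sB0 : 0 <= sB. Proof. by have [] := fnorm_sin_angle LB Lf f1. Qed.

Let sin_anglesE : sin_angles f = sA * sB.
Proof. by rewrite /sin_angles ger0_norm// mulr_ge0. Qed.

Let nsA : Num.sqrt (rip A A) * sA = dA.
Proof. by have [_] := fnorm_sin_angle LA Lf f1; rewrite inA. Qed.

Let nsB : Num.sqrt (rip B B) * sB = dB.
Proof. by have [_] := fnorm_sin_angle LB Lf f1; rewrite inB. Qed.

Lemma lhs_prodE : lhs_prod f = (dA * dB)%:E.
Proof.
rewrite /lhs_prod lhs_fock// !fnorm_rip// sin_anglesE -!EFinM -nsA -nsB.
by congr (_%:E); ring.
Qed.

Lemma dAdB_ge1 : 1 <= dA * dB. Proof. by rewrite -f1; exact: lhs_norms_ge. Qed.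

Lemma dAdB_eq1 : dA * dB = 1 <->
  exists c : R, 0 < c /\ forall z, A z - inner A f * f z = - c%:C * (B z - inner B f * f z).
Proof.
rewrite -f1 inA inB.
rewrite (rip_cauchy_schwarz_eq (U := U p0) (V := V q0) _ _ f0); last exact: rip_shifted.
- by split=> [[c c0 H]|[c [c0 H]]]; [exists c|exists c].
- exact: L2_subZ.
- exact: L2_subZ.
Qed.

Lemma dAdB_extremal : dA * dB = 1 <-> exists (c a b : R) (C : R[i]),
  [/\ 0 < c, C != 0 & f =1 extremal a b c C].
Proof.
split.
  rewrite -f1 => /(lhs_norms_eq p0 q0 f0)[c [C [c0 fC]]].
  exists c, p0, q0, C; split => //; apply/eqP => C0.
  have fz : forall z, f z = 0 by move=> z; rewrite fC /extremal C0 mul0r.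
  have : rip f f = 0.
    rewrite -(intg_cst0 R) /rip; congr (intg _); apply/funext => p.
    by rewrite /re_at /im_at /at_point fz /= mul0r addr0 mul0r.
  by rewrite f1 => /eqP; rewrite oner_eq0.
move=> [c [a [b [C [c0 _ fC]]]]].
(* The given a and b are not known to be the optimal shifts. They give equality in the first
   inequality; the distances are no larger, and their product is at least 1. *)
have E : Num.sqrt (rip (U a) (U a)) * Num.sqrt (rip (V b) (V b)) = 1.
  by rewrite -f1; apply/(lhs_norms_eq a b f0); exists c, C.
apply/eqP; rewrite eq_le dAdB_ge1 andbT -lee_fin -lhs_distE -E.
rewrite /lhs_dist lhs_fock// EFinM -!fnorm_rip; [|exact: L2_subZ|exact: L2_subZ].
apply: lee_pmul.
- by rewrite dist_line_proj// sqrte_ge0.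
- by rewrite dist_line_proj// sqrte_ge0.
- by apply: ereal_inf_lbound; exists a%:C.
- by apply: ereal_inf_lbound; exists (0 +i* b).
Qed.

Lemma lhs_sumE : lhs_sum f = ((rip A A + rip B B) / 2 * (sA * sB))%:E.
Proof.
have LM : L2 (mulz f) by exact: L2_mulz.
rewrite /lhs_sum lhs_fock// !fnorm_rip// sin_anglesE -!EFin_expe !sqr_sqrtr ?rip_ge0//.
rewrite -EFinD -EFinM (parallelogram Ef ED Lf LD).
by congr (_%:E); field.
Qed.

(** With m and n the norms of f' + z f and f' - z f, and s the product of the sines, (m^2 + n^2) s /
    2 = m n s + (m - n)^2 s / 2. Here m n s = [dA * dB] is at least 1, which forces s > 0, so
    equality means m = n and m n s = 1. *)
Lemma lhs_sum_ge : 1 <= (rip A A + rip B B) / 2 * (sA * sB) /\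
  ((rip A A + rip B B) / 2 * (sA * sB) = 1 <->
   Num.sqrt (rip A A) = Num.sqrt (rip B B) /\ dA * dB = 1).
Proof.
have := dAdB_ge1; rewrite -nsA -nsB.
have := sqr_sqrtr (rip_ge0 A); have := sqr_sqrtr (rip_ge0 B).
have := sqrtr_ge0 (rip A A); have := sqrtr_ge0 (rip B B).
move: (Num.sqrt (rip A A)) (Num.sqrt (rip B B)) => m n n0 m0 <- <-.
have s0 : 0 <= sA * sB by rewrite mulr_ge0.
move: (sA * sB) s0 (mulrACA m sA n sB) => s s0 -> H.
have sp : 0 < s by rewrite lt_def s0 andbT; apply/eqP => sz; move: H; rewrite sz; lra.
have E : (m ^+ 2 + n ^+ 2) / 2 * s = m * n * s + (m - n) ^+ 2 / 2 * s by field.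
have Q : 0 <= (m - n) ^+ 2 / 2 * s by rewrite mulr_ge0// divr_ge0// sqr_ge0.
split; first by rewrite E; lra.
split=> [H1|[mn H1]]; last by rewrite E H1 mn subrr expr0n !mul0r addr0.
have Q0 : (m - n) ^+ 2 / 2 * s = 0 by rewrite E in H1; lra.
move/eqP: (Q0); rewrite mulf_eq0 (gt_eqF sp) orbF mulf_eq0 invr_eq0 pnatr_eq0 orbF.
rewrite sqrf_eq0 subr_eq0 => /eqP mn; split => //.
by rewrite E Q0 addr0 in H1.
Qed.

Lemma lhs_sum_eq1 : lhs_sum f = 1%E <->
  fnorm A = fnorm B /\ exists c : R, 0 < c /\
    forall z, A z - inner A f * f z = - c%:C * (B z - inner B f * f z).
Proof.
rewrite lhs_sumE !fnorm_rip//; have [_ H] := lhs_sum_ge.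
split=> [[]/H[-> /dAdB_eq1]//|[[E] /dAdB_eq1 E1]].
by congr (_%:E); apply/H.
Qed.

End unit_vector.
End with_derivative.
End uncertainty.

Unset Implicit Arguments.

Theorem mainTheorem1 (R : realType) :
  (forall f : R[i] -> R[i], fock f -> forall a b : R,
     (fnorm f ^+ 2 <= lhs_norms f a b)%E
     /\ (lhs_norms f a b = (fnorm f ^+ 2)%E <->
         exists (c : R) (C : R[i]), 0 < c /\ f =1 extremal a b c C))
  /\
  (forall f : R[i] -> R[i], fock f -> fnorm f = 1%E ->
     [/\ (1 <= lhs_dist f)%E,
         (1 <= lhs_prod f)%E,
         (1 <= lhs_sum f)%E,
         (lhs_dist f = 1%E <->
          exists (c a b : R) (C : R[i]),
            [/\ 0 < c, C != 0 & f =1 extremal a b c C]) &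
         (lhs_prod f = 1%E <->
          exists (c a b : R) (C : R[i]),
            [/\ 0 < c, C != 0 & f =1 extremal a b c C])]
     /\ (lhs_sum f = 1%E <->
         fnorm (fplus f) = fnorm (fminus f)
         /\ exists c : R, 0 < c /\
            forall z : R[i],
              fplus f z - inner (fplus f) f * f z
              = - c%:C * (fminus f z - inner (fminus f) f * f z))).
Proof.
split=> f Ff => [a b|f1]; have [Ef Lf] := (fockP f).1 Ff.
  rewrite sqr_fnorm//; have [FD|ND] := pselect (fock (cderiv f)); last first.
    (* Both sides of the equivalence fail: +oo is not the finite square norm, and an extremal f
       would have its derivative in the Fock space. *)
    rewrite /lhs_norms lhs_Nfock// leey; split=> //; split=> // -[c [C [c0 fC]]].
    by case: ND; exact: extremal_fock_deriv fC.
  rewrite lhs_normsE// lee_fin; split; first exact: lhs_norms_ge.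
  (* The equality case of Cauchy-Schwarz was proved for a nonzero product, so the zero function is
     treated apart: it is extremal with C = 0, and both sides of the inequality are 0. *)
  have [f0|fN] := eqVneq (rip f f) 0; last first.
    have f0 : 0 < rip f f by rewrite lt_def fN rip_ge0.
    rewrite -(lhs_norms_eq Ff FD a b f0).
    by split=> [[]//|->].
  have fz := rip_eq0 Lf f0; split=> [_|_].
    by exists 1, 0; split => // z; rewrite fz /extremal mul0r.
  have Dz z : cderiv f z = 0.
    have fE : f = (fun=> 0) by apply/funext.
    by have /cdiffP[_] := cdiff_cst (0 : R[i]) z; rewrite -fE.
  have LU : L2 (subZ (fplus f) a%:C f).
    have [ED LD] := (fockP _).1 FD.
    by apply: L2_subZ => //; exact: L2_fplus.
  (* The zero vector written as - 0 times itself, so that [rip_scale] gives norm zero. *)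
  have Uz z : subZ (fplus f) a%:C f z = - (0 : R)%:C * subZ (fplus f) a%:C f z.
    by rewrite /subZ /fplus /mulz Dz fz !mulr0 addr0 subr0 mulr0.
  by rewrite (rip_scale LU LU Uz) f0 oppr0 mul0r sqrtr0 mul0r.
have {}f1 : rip f f = 1.
  by have := sqr_fnorm Ff; rewrite f1 expe2 mul1e => -[<-].
have [FD|ND] := pselect (fock (cderiv f)); last first.
  have NE : ~ exists (c a b : R) (C : R[i]), [/\ 0 < c, C != 0 & f =1 extremal a b c C].
    by move=> [c [a [b [C [c0 _ fC]]]]]; apply: ND; exact: extremal_fock_deriv fC.
  rewrite /lhs_dist /lhs_prod /lhs_sum !lhs_Nfock// leey.
  split; first by split.
  by split=> // -[_ [c [c0 H]]]; case: ND; exact: shifted_fock_deriv H.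
split; last exact: lhs_sum_eq1.
rewrite (lhs_distE Ff FD f1) (lhs_prodE Ff FD f1) (lhs_sumE Ff FD f1) !lee_fin.
have d1 := dAdB_ge1 Ff FD f1; have [s1 _] := lhs_sum_ge Ff FD f1.
have E := dAdB_extremal Ff FD f1.
by split=> //; rewrite -E; split=> [[]|->].
Qed.
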